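(* Let $\gamma_1,\gamma_2,\gamma_3,\delta_1,\delta_2,\delta_3,x,y\in\mathbb{C}$, let $\alpha_1,\dots,\alpha_4,\beta_1,\dots,\beta_4$ be positive real numbers, and let $\mu\in\mathbb{C}$ with $\operatorname{Re}\mu>\operatorname{Re}\gamma_1>0$. Then $$D_1\left(\begin{matrix}\gamma_1,\alpha_1,\beta_1;\gamma_2,\alpha_2;\gamma_3,\beta_2;\\ \delta_1,\alpha_3,\beta_3;\delta_2,\alpha_4;\delta_3,\beta_4;\end{matrix}\left|\begin{matrix}x\\ y\end{matrix}\right.\right)=\frac{\Gamma(\mu)}{\Gamma(\gamma_1)\Gamma(\mu-\gamma_1)}\int_0^1\xi^{\gamma_1-1}(1-\xi)^{\mu-\gamma_1-1}D_1\left(\begin{matrix}\mu,\alpha_1,\beta_1;\gamma_2,\alpha_2;\gamma_3,\beta_2;\\ \delta_1,\alpha_3,\beta_3;\delta_2,\alpha_4;\delta_3,\beta_4;\end{matrix}\left|\begin{matrix}x\xi^{\alpha_1}\\ y\xi^{\beta_1}\end{matrix}\right.\right)d\xi.$$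
   Context: $(\gamma)_\lambda=\Gamma(\gamma+\lambda)/\Gamma(\gamma)$ for $\gamma\in\mathbb{C}$ and real $\lambda\ge0$. For complex $\gamma_i,\delta_i,x,y$ and positive real $\alpha_i,\beta_i$, $$D_1\left(\begin{matrix}\gamma_1,\alpha_1,\beta_1;\gamma_2,\alpha_2;\gamma_3,\beta_2;\\ \delta_1,\alpha_3,\beta_3;\delta_2,\alpha_4;\delta_3,\beta_4;\end{matrix}\left|\begin{matrix}x\\ y\end{matrix}\right.\right)=\sum_{m,n=0}^{\infty}\frac{(\gamma_1)_{\alpha_1 m+\beta_1 n}(\gamma_2)_{\alpha_2 m}(\gamma_3)_{\beta_2 n}}{\Gamma(\delta_1+\alpha_3 m+\beta_3 n)}\frac{x^m}{\Gamma(\delta_2+\alpha_4 m)}\frac{y^n}{\Gamma(\delta_3+\beta_4 n)}.$$ The functions are considered at arguments in the region of absolute convergence of their defining series. *)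

(* Defs.v *)
From HB Require Import structures.
From mathcomp Require Import all_boot all_order all_algebra.
From mathcomp Require Import all_classical all_reals all_analysis.
From mathcomp Require Import complex.
Set Implicit Arguments.
Unset Strict Implicit.
Unset Printing Implicit Defensive.
Import Order.TTheory GRing.Theory Num.Theory.
Import numFieldNormedType.Exports.
Local Open Scope classical_set_scope.
Local Open Scope ring_scope.
Local Open Scope complex_scope.

(* The topology on the complex numbers is the one of [R[i]^o], given by the
   modulus. *)

Section ComplexFunctions.
Context {R : realType}.
Local Notation C := R[i].

Definition cexp (z : C) : C :=
  (expR (complex.Re z) * cos (complex.Im z))
    +i* (expR (complex.Re z) * sin (complex.Im z)).

(* Principal value of r ^ z, for a positive real base r. *)
Definition cpow (r : R) (z : C) : C := cexp (z * (ln r)%:C).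

(* Euler's limit n! n^z / (z (z + 1) ... (z + n)), valid at every z that is not
   a pole. At a pole 0, -1, -2, ... a factor of the denominator vanishes for
   all large n, so that Gamma z = 0 there; hence (Gamma z)^-1 = 0, which makes
   (Gamma z)^-1 the entire function 1 / Gamma at every z. *)
Definition Gamma (z : C) : C :=
  limn (fun n : nat =>
    (n`!%:R * cpow n%:R z / \prod_(k < n.+1) (z + k%:R) : C^o)).

(* (g)_l = Gamma (g + l) / Gamma g; when g is a pole of Gamma, the quotient is
   extended by continuity in g, which gives the usual values
   (- k)_n = (- k) (- k + 1) ... (- k + n - 1), and (- k)_l = 0 if l is not an
   integer. *)
Definition poch (g : C) (l : R) : C :=
  if `[< exists k : nat, g = - k%:R >]
  then lim ((fun z : C^o => (Gamma (z + l%:C) / Gamma z : C^o)) @ (g : C^o)^')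
  else Gamma (g + l%:C) / Gamma g.

Definition cintegrable (D : set R) (f : R -> C) : Prop :=
  (@lebesgue_measure R).-integrable D (EFin \o (fun t => complex.Re (f t))) /\
  (@lebesgue_measure R).-integrable D (EFin \o (fun t => complex.Im (f t))).

Definition cintegral (D : set R) (f : R -> C) : C :=
  (\int[@lebesgue_measure R]_(t in D) complex.Re (f t))
    +i* (\int[@lebesgue_measure R]_(t in D) complex.Im (f t)).

End ComplexFunctions.

Section D1.
Context {R : realType}.
Local Notation C := R[i].
Variables (g1 : C) (a1 b1 : R) (g2 : C) (a2 : R) (g3 : C) (b2 : R).
Variables (d1 : C) (a3 b3 : R) (d2 : C) (a4 : R) (d3 : C) (b4 : R).
Variables (x y : C).

Definition D1_term (m n : nat) : C :=
  poch g1 (a1 * m%:R + b1 * n%:R) * poch g2 (a2 * m%:R) * poch g3 (b2 * n%:R)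
    / Gamma (d1 + (a3 * m%:R + b3 * n%:R)%:C)
  * (x ^+ m / Gamma (d2 + (a4 * m%:R)%:C))
  * (y ^+ n / Gamma (d3 + (b4 * n%:R)%:C)).

Definition D1_abs_cvg : Prop :=
  (\esum_(p in [set: nat * nat]) (Normc.normc (D1_term p.1 p.2))%:E < +oo)%E.

(* Under [D1_abs_cvg] the order of summation is immaterial. *)
Definition D1 : C :=
  limn (series (fun m : nat => limn (series (D1_term m : nat -> C^o)) : C^o)).

End D1.

(* Main.v *)
Require Import Defs.
From mathcomp Require Import all_boot all_order all_algebra.
From mathcomp Require Import all_classical all_reals all_analysis.
From mathcomp Require Import complex.
From mathcomp Require Import measurable_realfun ring lra.
Set Implicit Arguments.
Unset Strict Implicit.
Unset Printing Implicit Defensive.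
Import Order.TTheory GRing.Theory Num.Theory.
Import numFieldNormedType.Exports.
Local Open Scope classical_set_scope.
Local Open Scope ring_scope.
Local Open Scope complex_scope.

(** Write D1 as the double series of the terms
    (g1)_l W, with l = a1 m + b1 n and W the part of the term that depends
    neither on g1 nor on mu.  Replacing (x, y) by (x xi^a1, y xi^b1) multiplies
    W by xi^l, so each term of the integrand is
      (mu)_l W xi^(g1 + l - 1) (1 - xi)^(mu - g1 - 1),
    and Euler's beta integral ([Beta_Gamma]) gives its integral
      (mu)_l W Gamma(g1 + l) Gamma(mu - g1) / Gamma(mu + l),
    which is Gamma(g1) Gamma(mu - g1) / Gamma(mu) times (g1)_l W
    ([poch_Beta]).  What remains is to exchange the integral with the two sums.

    The exchange is dominated convergence, used once for each summation
    ([cintegral_dseries]); it needs the sum of the integrals of the moduli to be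
    finite.  The modulus of a term has a beta integral with the real exponents
    Re g1 + l and Re (mu - g1) as its integral, so the bound to be shown is
      |(mu)_l| B(Re g1 + l, Re (mu - g1)) <= K |(g1)_l|
    with K independent of l ([normc_poch_Beta_le]).  It follows from
    |Gamma z| <= Gamma (Re z), used at z = mu + l, and from the fact that
    |Gamma (z + l)| / Gamma (Re z + l) is at least |Gamma z| / Gamma (Re z), used
    at z = g1 ([normc_Gamma_le], [normc_Gamma_shift]); both are read off factor
    by factor from Euler's product.  Thus the absolute convergence of the series
    on the left-hand side dominates the integrand.

    Gamma is given by Euler's limit n! n^z / (z (z + 1) ... (z + n)).  For
    Re z > 0 the ratio of consecutive terms is 1 + O(1/n^2), so both the
    sequence and its inverse converge, and the limit is not 0
    ([cvg_Gamma_neq0]).  The beta integral is evaluated against this limit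
    without passing through the integral of t^(z-1) e^(-t): integration by
    parts gives (a + b) B(a, b + 1) = b B(a, b), so that n^a B(a, n + 1) is the
    n-th term of Euler's sequence for a, while n^a B(a, b + n + 1) has the same
    limit and is expressed by B(a, b) and the sequences for b and a + b. *)

(** * Modulus, limits and real-variable calculus of complex numbers *)

Section Modulus.
Context {R : realType}.
Local Notation C := R[i].
Local Notation Re := (@complex.Re R).
Local Notation Im := (@complex.Im R).
Local Notation normc := (@Normc.normc R).
Implicit Types (z w : C) (u v : nat -> C).

Lemma cReD z w : Re (z + w) = Re z + Re w. Proof. by case: z; case: w. Qed.
Lemma cImD z w : Im (z + w) = Im z + Im w. Proof. by case: z; case: w. Qed.
Lemma cReN z : Re (- z) = - Re z. Proof. by case: z. Qed.
Lemma cImN z : Im (- z) = - Im z. Proof. by case: z. Qed.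
Lemma cReB z w : Re (z - w) = Re z - Re w. Proof. by rewrite cReD cReN. Qed.
Lemma cImB z w : Im (z - w) = Im z - Im w. Proof. by rewrite cImD cImN. Qed.
Lemma cReM z w : Re (z * w) = Re z * Re w - Im z * Im w.
Proof. by case: z; case: w. Qed.
Lemma cImM z w : Im (z * w) = Re z * Im w + Im z * Re w.
Proof. by case: z; case: w. Qed.
Lemma Re_nat n : Re n%:R = n%:R. Proof. by rewrite -(rmorph_nat (real_complex R)). Qed.
Lemma Im_nat n : Im n%:R = 0. Proof. by rewrite -(rmorph_nat (real_complex R)). Qed.

Lemma Re_sum (I : Type) (s : seq I) (P : pred I) (F : I -> C) :
  Re (\sum_(i <- s | P i) F i) = \sum_(i <- s | P i) Re (F i).
Proof. exact: (big_morph Re cReD). Qed.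
Lemma Im_sum (I : Type) (s : seq I) (P : pred I) (F : I -> C) :
  Im (\sum_(i <- s | P i) F i) = \sum_(i <- s | P i) Im (F i).
Proof. exact: (big_morph Im cImD). Qed.

Lemma complex_ext z w : Re z = Re w -> Im z = Im w -> z = w.
Proof. by case: z => a b; case: w => c d /= -> ->. Qed.

Lemma normc_ge0 z : 0 <= normc z.
Proof. by case: z => a b /=; rewrite sqrtr_ge0. Qed.

Lemma normc_real (r : R) : normc r%:C = `|r|.
Proof. by rewrite /= expr0n addr0 sqrtr_sqr. Qed.

Lemma normc_nat n : normc n%:R = n%:R.
Proof. by rewrite -(rmorph_nat (real_complex R)) normc_real ger0_norm. Qed.

Lemma normc_sqr z : normc z ^+ 2 = Re z ^+ 2 + Im z ^+ 2.
Proof. by case: z => a b /=; rewrite sqr_sqrtr ?addr_ge0 ?sqr_ge0. Qed.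

Lemma Re_le_normc z : `|Re z| <= normc z.
Proof.
by rewrite -(@ler_pXn2r _ 2) ?nnegrE ?normc_ge0// normc_sqr real_normK ?num_real//
  lerDl sqr_ge0.
Qed.

Lemma Im_le_normc z : `|Im z| <= normc z.
Proof.
by rewrite -(@ler_pXn2r _ 2) ?nnegrE ?normc_ge0// normc_sqr real_normK ?num_real//
  lerDr sqr_ge0.
Qed.

Lemma normc_le_ReIm z : normc z <= `|Re z| + `|Im z|.
Proof.
rewrite -(@ler_pXn2r _ 2) ?nnegrE ?normc_ge0 ?addr_ge0// normc_sqr sqrrD.
by rewrite !real_normK ?num_real// -addrA lerD2l lerDr mulrn_wge0// mulr_ge0.
Qed.

Lemma normc_prod (I : Type) (s : seq I) (P : pred I) (F : I -> C) :
  normc (\prod_(i <- s | P i) F i) = \prod_(i <- s | P i) normc (F i).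
Proof. exact: (big_morph normc (@Normc.normcM R) (@Normc.normc1 R)). Qed.

Lemma normc_sum_le (I : Type) (s : seq I) (P : pred I) (F : I -> C) :
  normc (\sum_(i <- s | P i) F i) <= \sum_(i <- s | P i) normc (F i).
Proof.
elim/big_ind2 : _ => //; first by rewrite Normc.normc0.
by move=> z a w b za wb; rewrite (le_trans (le_normcD _ _))// lerD.
Qed.

Lemma normc_eq0 z : (normc z == 0) = (z == 0).
Proof.
apply/eqP/eqP => [/Normc.eq0_normc//|->]; exact: Normc.normc0.
Qed.

Lemma normc_gt0 z : (0 < normc z) = (z != 0).
Proof. by rewrite lt_neqAle normc_ge0 andbT eq_sym normc_eq0. Qed.

Lemma normrE z : `|z| = (normc z)%:C.
Proof. by case: z. Qed.

(** Convergence in the topology of the modulus is stated in R[i], while the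
    estimates are made in R: this equivalence and the lemmas after it pass from
    one to the other. *)
Lemma cvgC_normc u z :
  ((fun n => u n : C^o) @ \oo --> (z : C^o)) <->
  (fun n => normc (u n - z)) @ \oo --> (0 : R).
Proof.
split => [/cvgrPdist_lt uz | uz].
- apply/cvgr0Pnorm_lt => e e0.
  have /uz : (0 < e%:C :> C) by rewrite ltcR.
  apply: filterS => n; rewrite distrC normrE ltcR => h.
  by rewrite ger0_norm ?normc_ge0.
- apply/cvgrPdist_lt => e e0.
  have e0' : e = (Re e)%:C.
    by move: e0; rewrite ltcE => /andP[/eqP]; case: e => a b /= ->.
  have Re0 : 0 < Re e by move: e0; rewrite ltcE => /andP[].
  move/cvgr0Pnorm_lt : uz => /(_ _ Re0); apply: filterS => n.
  by rewrite ger0_norm ?normc_ge0// distrC normrE [e]e0' ltcR.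
Qed.


Lemma cvg_le0 (a b : nat -> R) : (forall n, 0 <= a n <= b n) ->
  b @ \oo --> (0 : R) -> a @ \oo --> (0 : R).
Proof.
move=> ab b0; apply: (squeeze_cvgr _ (cvg_cst (0 : R)) b0).
by near=> n; exact: ab.
Unshelve. all: by end_near. Qed.

Lemma cvg_dist_le (a b : nat -> R) (l : R) : (forall n, `|a n - l| <= b n) ->
  b @ \oo --> (0 : R) -> a @ \oo --> l.
Proof.
move=> ab b0; apply/subr_cvg0; apply: norm_cvg0.
by apply: (@cvg_le0 _ b) => // n; rewrite normr_ge0/=; exact: ab.
Qed.

Lemma cvgC_Re u z : ((fun n => u n : C^o) @ \oo --> (z : C^o)) ->
  (fun n => Re (u n)) @ \oo --> Re z.
Proof.
move=> /cvgC_normc uz; apply: cvg_dist_le uz => n.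
by rewrite -cReB; exact: Re_le_normc.
Qed.

Lemma cvgC_Im u z : ((fun n => u n : C^o) @ \oo --> (z : C^o)) ->
  (fun n => Im (u n)) @ \oo --> Im z.
Proof.
move=> /cvgC_normc uz; apply: cvg_dist_le uz => n.
by rewrite -cImB; exact: Im_le_normc.
Qed.

Lemma cvgC_ReIm u z : (fun n => Re (u n)) @ \oo --> Re z ->
  (fun n => Im (u n)) @ \oo --> Im z ->
  (fun n => u n : C^o) @ \oo --> (z : C^o).
Proof.
move=> /subr_cvg0 uR /subr_cvg0 uI; apply/cvgC_normc.
apply: (@cvg_le0 _ (fun n => `|Re (u n) - Re z| + `|Im (u n) - Im z|)).
  by move=> n; rewrite normc_ge0/= -cReB -cImB normc_le_ReIm.
rewrite -[X in _ --> X](addr0 (0 : R)).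
by apply: cvgD; [move/cvg_norm : uR|move/cvg_norm : uI]; rewrite normr0.
Qed.

Lemma cvgC_cst z : (fun _ : nat => z : C^o) @ \oo --> (z : C^o).
Proof. exact: cvg_cst. Qed.

Lemma cvgC_D u v z w : (fun n => u n : C^o) @ \oo --> (z : C^o) ->
  (fun n => v n : C^o) @ \oo --> (w : C^o) ->
  (fun n => (u n + v n) : C^o) @ \oo --> (z + w : C^o).
Proof.
move=> uz vw; apply: cvgC_ReIm.
- under eq_fun do rewrite cReD; rewrite cReD.
  by apply: cvgD; exact: cvgC_Re.
- under eq_fun do rewrite cImD; rewrite cImD.
  by apply: cvgD; exact: cvgC_Im.
Qed.

Lemma cvgC_M u v z w : (fun n => u n : C^o) @ \oo --> (z : C^o) ->
  (fun n => v n : C^o) @ \oo --> (w : C^o) ->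
  (fun n => (u n * v n) : C^o) @ \oo --> (z * w : C^o).
Proof.
move=> uz vw; apply: cvgC_ReIm.
- under eq_fun do rewrite cReM; rewrite cReM.
  by apply: cvgB; apply: cvgM; do ?[exact: cvgC_Re|exact: cvgC_Im].
- under eq_fun do rewrite cImM; rewrite cImM.
  by apply: cvgD; apply: cvgM; do ?[exact: cvgC_Re|exact: cvgC_Im].
Qed.

Lemma cvgC_norm u z : (fun n => u n : C^o) @ \oo --> (z : C^o) ->
  (fun n => normc (u n)) @ \oo --> normc z.
Proof.
move=> /cvgC_normc uz; apply: cvg_dist_le uz => n.
rewrite ler_norml; apply/andP; split.
- rewrite lerNl opprB lerBlDr -(normcN (u n - z)) opprB.
  by rewrite (le_trans _ (le_normcD _ _))// subrK.
- by rewrite lerBlDr (le_trans _ (le_normcD _ _))// subrK.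
Qed.

Lemma limC u z : (fun n => u n : C^o) @ \oo --> (z : C^o) ->
  limn (fun n => u n : C^o) = z.
Proof. by move=> uz; apply: cvg_lim => //; exact: norm_hausdorff. Qed.

Lemma cvgC_unique u z w : (fun n => u n : C^o) @ \oo --> (z : C^o) ->
  (fun n => u n : C^o) @ \oo --> (w : C^o) -> z = w.
Proof. by move=> /limC <- /limC <-. Qed.

Lemma cvgC_series u (v : nat -> R) : (forall n, normc (u n) <= v n) ->
  cvgn (series v) -> cvgn (series (fun n => u n : C^o)).
Proof.
move=> uv cv.
have cvR : cvgn (series (fun n => Re (u n))).
  apply: normed_cvg; apply: series_le_cvg cv => n; rewrite ?normr_ge0//.
  - by rewrite (le_trans _ (uv n))// normc_ge0.
  - by rewrite (le_trans (Re_le_normc _)).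
have cvI : cvgn (series (fun n => Im (u n))).
  apply: normed_cvg; apply: series_le_cvg cv => n; rewrite ?normr_ge0//.
  - by rewrite (le_trans _ (uv n))// normc_ge0.
  - by rewrite (le_trans (Im_le_normc _)).
pose l := limn (series (fun n => Re (u n))) +i* limn (series (fun n => Im (u n))).
apply/cvg_ex; exists (l : C^o); apply: cvgC_ReIm.
- rewrite (_ : (fun n => _) = series (fun n => Re (u n)))//.
  by apply/funext => n; rewrite /series/= Re_sum.
- rewrite (_ : (fun n => _) = series (fun n => Im (u n)))//.
  by apply/funext => n; rewrite /series/= Im_sum.
Qed.

End Modulus.

Section ComplexPower.
Context {R : realType}.
Local Notation C := R[i].
Local Notation Re := (@complex.Re R).
Local Notation Im := (@complex.Im R).
Local Notation normc := (@Normc.normc R).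
Implicit Types (z w : C) (r s t : R).

Lemma cexpD z w : cexp (z + w) = cexp z * cexp w.
Proof.
apply: complex_ext; rewrite ?cReM ?cImM /= cReD cImD expRD ?cosD ?sinD; ring.
Qed.

Lemma cexp0 : cexp (0 : C) = 1.
Proof. by rewrite /cexp/= expR0 cos0 sin0 mulr0 mulr1. Qed.

Lemma normc_cexp z : normc (cexp z) = expR (Re z).
Proof.
rewrite /= !exprMn -mulrDr cos2Dsin2 mulr1 sqrtr_sqr ger0_norm//.
Qed.

Lemma cpowD r z w : cpow r (z + w) = cpow r z * cpow r w.
Proof. by rewrite /cpow mulrDl cexpD. Qed.

Lemma cpow0 r : cpow r (0 : C) = 1.
Proof. by rewrite /cpow mul0r cexp0. Qed.

Lemma cpow_real r s : 0 < r -> cpow r s%:C = (r `^ s)%:C.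
Proof.
move=> r0; rewrite /cpow /cexp /= !(mul0r, mulr0, subr0, add0r) cos0 sin0 mulr1 mulr0.
by rewrite /powR gt_eqF.
Qed.

Lemma cpow1 r : 0 < r -> cpow r (1 : C) = r%:C.
Proof. by move=> r0; rewrite (_ : 1 = 1%:C)// cpow_real// powRr1// ltW. Qed.

Lemma cpow_nat (r : R) n : 0 < r -> cpow r n%:R = (r ^+ n)%:C.
Proof.
by move=> r0; rewrite -(rmorph_nat (real_complex R)) cpow_real// powR_mulrn// ltW.
Qed.

Lemma cpow1x z : cpow (1 : R) z = 1.
Proof. by rewrite /cpow ln1 mulr0 cexp0. Qed.

Lemma normc_cpow r z : 0 < r -> normc (cpow r z) = r `^ Re z.
Proof.
move=> r0; rewrite /cpow normc_cexp cReM /= mulr0 subr0.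
by rewrite /powR gt_eqF.
Qed.

Lemma cpow_neq0 r z : cpow r z != 0.
Proof. by rewrite -normc_gt0 normc_cexp expR_gt0. Qed.

Lemma cpowN r z : cpow r (- z) = (cpow r z)^-1.
Proof.
apply: (mulfI (cpow_neq0 r z)).
by rewrite -cpowD subrr cpow0 mulfV// cpow_neq0.
Qed.

Lemma cpowMl r s z : 0 < r -> 0 < s -> cpow (r * s) z = cpow r z * cpow s z.
Proof.
by move=> r0 s0; rewrite /cpow lnM ?posrE// rmorphD/= mulrDr cexpD.
Qed.

End ComplexPower.

Section ComplexDerivative.
Context {R : realType}.
Local Notation C := R[i].
Local Notation Re := (@complex.Re R).
Local Notation Im := (@complex.Im R).
Local Notation normc := (@Normc.normc R).
Implicit Types (z w d e : C) (t a b : R) (f g : R -> C).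

Definition cderiv t f d : Prop :=
  is_derive t 1 (fun s => Re (f s)) (Re d) /\
  is_derive t 1 (fun s => Im (f s)) (Im d).

Lemma cderiv_cst t z : cderiv t (fun=> z) 0.
Proof. by split; exact: is_derive_cst. Qed.

Lemma cderiv_id t : cderiv t (fun s => s%:C) 1.
Proof. by split => /=; [exact: is_derive_id|exact: is_derive_cst]. Qed.

Lemma cderivM t f g d e : cderiv t f d -> cderiv t g e ->
  cderiv t (fun s => f s * g s) (d * g t + f t * e).
Proof.
move=> [fR fI] [gR gI]; split.
- rewrite (_ : (fun s => _) =
    (fun s => Re (f s)) * (fun s => Re (g s)) - (fun s => Im (f s)) * (fun s => Im (g s))).
    apply: (is_derive_eq (is_deriveB (is_deriveM fR gR) (is_deriveM fI gI))).
    by rewrite cReD !cReM /GRing.scale/=; ring.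
  by apply/funext => s; rewrite cReM.
- rewrite (_ : (fun s => _) =
    (fun s => Re (f s)) * (fun s => Im (g s)) + (fun s => Im (f s)) * (fun s => Re (g s))).
    apply: (is_derive_eq (is_deriveD (is_deriveM fR gI) (is_deriveM fI gR))).
    by rewrite cImD !cImM /GRing.scale/=; ring.
  by apply/funext => s; rewrite cImM.
Qed.

Lemma cderivB t f g d e : cderiv t f d -> cderiv t g e ->
  cderiv t (fun s => f s - g s) (d - e).
Proof.
move=> [fR fI] [gR gI]; split.
- rewrite (_ : (fun s => _) = (fun s => Re (f s)) - (fun s => Re (g s))).
    by rewrite cReB; exact: is_deriveB.
  by apply/funext => s; rewrite cReB.
- rewrite (_ : (fun s => _) = (fun s => Im (f s)) - (fun s => Im (g s))).
    by rewrite cImB; exact: is_deriveB.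
  by apply/funext => s; rewrite cImB.
Qed.

Lemma cderiv_onem t f d : cderiv (1 - t) f d ->
  cderiv t (fun s => f (1 - s)) (- d).
Proof.
have onem : is_derive t 1 (fun s : R => 1 - s) (-1).
  rewrite (_ : (fun s => _) = cst 1 - id)//.
  by apply: is_derive_eq; rewrite sub0r.
move=> [fR fI]; split.
- rewrite (_ : (fun s => _) = (fun s => Re (f s)) \o (fun s => 1 - s))//.
  by apply: is_derive_eq; rewrite cReN mulrN1.
- rewrite (_ : (fun s => _) = (fun s => Im (f s)) \o (fun s => 1 - s))//.
  by apply: is_derive_eq; rewrite cImN mulrN1.
Qed.

Lemma cderiv_cpow t z : 0 < t ->
  cderiv t (fun s => cpow s z) (z * cpow t (z - 1)).
Proof.
move=> t0; have dln := is_derive1_ln t0.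
have -> : z * cpow t (z - 1) = z * (t^-1)%:C * cpow t z.
  by rewrite cpowD cpowN cpow1// -fmorphV/=; ring.
have h k : is_derive t 1 (fun s : R => k * ln s) (k * t^-1).
  exact: (is_deriveZ k dln).
have He := @is_derive1_comp _ _ (fun s => Re z * ln s) _ _ _ (is_derive_expR (Re z * ln t)) (h (Re z)).
have Hc := @is_derive1_comp _ _ (fun s => Im z * ln s) _ _ _ (is_derive_cos (Im z * ln t)) (h (Im z)).
have Hs := @is_derive1_comp _ _ (fun s => Im z * ln s) _ _ _ (is_derive_sin (Im z * ln t)) (h (Im z)).
have powE s : cpow s z = (expR (Re z * ln s) * cos (Im z * ln s))
    +i* (expR (Re z * ln s) * sin (Im z * ln s)).
  by rewrite /cpow /cexp cReM cImM/= !mulr0 subr0 add0r.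
split.
- rewrite (_ : (fun s => _) = (expR \o (fun s => Re z * ln s)) *
    (cos \o (fun s => Im z * ln s))); last by apply/funext => s; rewrite powE.
  apply: (is_derive_eq (is_deriveM He Hc)).
  by rewrite powE !cReM !cImM/= /GRing.scale/=; ring.
- rewrite (_ : (fun s => _) = (expR \o (fun s => Re z * ln s)) *
    (sin \o (fun s => Im z * ln s))); last by apply/funext => s; rewrite powE.
  apply: (is_derive_eq (is_deriveM He Hs)).
  by rewrite powE !cImM !cReM/= /GRing.scale/=; ring.
Qed.

Lemma cderiv_cts t f d : cderiv t f d ->
  {for t, continuous (fun s => Re (f s))} /\ {for t, continuous (fun s => Im (f s))}.
Proof.
move=> [[fR _] [fI _]].
by split; apply: differentiable_continuous; apply/derivable1_diffP.
Qed.

Lemma real_MVT_le (f df : R -> R) a b M : a <= b ->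
  (forall t, a <= t <= b -> is_derive t 1 f (df t)) ->
  (forall t, a <= t <= b -> `|df t| <= M) -> `|f b - f a| <= M * (b - a).
Proof.
move=> ab fd dM.
have fd' t : t \in `]a, b[ -> is_derive t 1 f (df t).
  by rewrite in_itv/= => /andP[? ?]; apply: fd; rewrite !ltW.
have cf : {within `[a, b], continuous f}.
  apply: derivable_within_continuous => t; rewrite in_itv/= => /fd[]//.
have [c] := MVT_segment ab fd' cf; rewrite in_itv/= => cab ->.
by rewrite normrM (ger0_norm (_ : 0 <= b - a)) ?subr_ge0// ler_wpM2r ?subr_ge0// dM.
Qed.

(** The factor 2 comes from applying the real mean value theorem to the real
    and imaginary parts separately. *)
Lemma cMVT_le f df a b M : a <= b ->
  (forall t, a <= t <= b -> cderiv t f (df t)) ->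
  (forall t, a <= t <= b -> normc (df t) <= M) ->
  normc (f b - f a) <= 2 * M * (b - a).
Proof.
move=> ab fd dM; rewrite (le_trans (normc_le_ReIm _))// cReB cImB.
rewrite (_ : 2 * M * (b - a) = M * (b - a) + M * (b - a)); last by ring.
apply: lerD.
- apply: (@real_MVT_le (fun t => Re (f t)) (fun t => Re (df t))) => // t tab; first exact: (fd t tab).1.
  by rewrite (le_trans (Re_le_normc _))// dM.
- apply: (@real_MVT_le (fun t => Im (f t)) (fun t => Im (df t))) => // t tab; first exact: (fd t tab).2.
  by rewrite (le_trans (Im_le_normc _))// dM.
Qed.

(** The mean value inequality is applied to f - (df a) t, whose derivative
    df t - df a is itself bounded by the mean value inequality. *)
Lemma cTaylor2_le f df ddf a b M : a <= b ->
  (forall t, a <= t <= b -> cderiv t f (df t)) ->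
  (forall t, a <= t <= b -> cderiv t df (ddf t)) ->
  (forall t, a <= t <= b -> normc (ddf t) <= M) ->
  normc (f b - f a - df a * (b - a)%:C) <= 4 * M * (b - a) ^+ 2.
Proof.
move=> ab fd dfd dM.
have -> : f b - f a - df a * (b - a)%:C =
    (f b - df a * b%:C) - (f a - df a * a%:C) by rewrite rmorphB/=; ring.
have -> : 4 * M * (b - a) ^+ 2 = 2 * (2 * M * (b - a)) * (b - a) by ring.
apply: (@cMVT_le (fun t => f t - df a * t%:C) (fun t => df t - df a)) => // t /andP[ta tb].
  apply: cderivB; first by apply: fd; rewrite ta.
  have := cderivM (cderiv_cst t (df a)) (cderiv_id t).
  by rewrite mul0r add0r mulr1.
apply: (@le_trans _ _ (2 * M * (t - a))).
  apply: (@cMVT_le df ddf) => // s /andP[sa st].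
    by apply: dfd; rewrite sa (le_trans st).
  by apply: dM; rewrite sa (le_trans st).
rewrite ler_wpM2l ?lerB// mulr_ge0// (le_trans (normc_ge0 (ddf a)))// dM// lexx ab//.
Qed.

End ComplexDerivative.

(** * Euler's limit for the Gamma function *)

Section EulerLimit.
Context {R : realType}.
Local Notation C := R[i].
Local Notation Re := (@complex.Re R).
Local Notation Im := (@complex.Im R).
Local Notation normc := (@Normc.normc R).
Implicit Types (z w : C).

(** The hypothesis on the steps gives |P n| <= |P 0| exp (v 0 + ... + v (n - 1)),
    so P is bounded and its increments form an absolutely convergent series.
    This is the convergence of an infinite product with ratios 1 + O(v n),
    stated so that it applies to the inverse of P as well. *)
Lemma cvg_small_steps (P : nat -> C) (v : nat -> R) : (forall n, 0 <= v n) ->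
  cvgn (series v) -> (forall n, normc (P n.+1 - P n) <= normc (P n) * v n) ->
  cvgn (fun n => P n : C^o).
Proof.
move=> v0 cv Pv.
have vle n : series v n <= limn (series v).
  apply: nondecreasing_cvgn_le => //; apply/nondecreasing_seqP => k.
  by rewrite /series/= big_nat_recr//= lerDl.
have Pexp n : normc (P n) <= normc (P 0) * expR (series v n).
  elim: n => [|n ih]; first by rewrite /series/= big_geq// expR0 mulr1.
  have -> : P n.+1 = P n + (P n.+1 - P n) by ring.
  rewrite (le_trans (le_normcD _ _))//.
  apply: (@le_trans _ _ (normc (P n) * (1 + v n))).
    by rewrite mulrDr mulr1 lerD2l.
  have -> : series v n.+1 = series v n + v n by rewrite /series/= big_nat_recr.
  rewrite expRD mulrA ler_pM ?normc_ge0 ?addr_ge0//.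
  exact: expR_ge1Dx.
pose B := normc (P 0) * expR (limn (series v)).
have PB n : normc (P n) <= B.
  by rewrite (le_trans (Pexp n))// ler_wpM2l ?normc_ge0// ler_expR.
have step n : normc (P n.+1 - P n) <= B * v n.
  by rewrite (le_trans (Pv n))// ler_wpM2r.
have cB : cvgn (series (fun n => B * v n)) by exact: (is_cvg_seriesZ (k := B) cv).
have /cvg_ex[/= l cl] := cvgC_series step cB.
apply/cvg_ex; exists (P 0 + l : C^o); apply/cvgC_normc.
move/cvgC_normc : cl; suff -> : (fun n => normc (P n - (P 0 + l))) =
  (fun n => normc (series (fun k => P k.+1 - P k : C^o) n - l)) by [].
by apply/funext => n; congr normc; rewrite /series/= telescope_sumr//; ring.
Qed.

Lemma is_cvg_series_invSsqr : cvgn (series (fun n => (n.+1%:R ^+ 2)^-1 : R)).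
Proof.
have le2 n : series (fun n => (n.+1%:R ^+ 2)^-1 : R) n.+1 <= 2 - n.+1%:R^-1.
  elim: n => [|n ih]; first by rewrite /series/= big_nat1 expr1n invr1; lra.
  rewrite /series/= big_nat_recr//= (le_trans (lerD ih (lexx _)))//.
  have n0 : 0 < n.+1%:R :> R by [].
  (* 1/x - 1/(x+1) = 1/(x (x+1)) dominates 1/(x+1)^2 *)
  rewrite -[n.+2%:R]natr1; set x : R := n.+1%:R in n0 *.
  have -> : x^-1 = (x + 1)^-1 + (x * (x + 1))^-1.
    by field; rewrite gt_eqF//= gt_eqF// addr_gt0.
  suff : ((x + 1) ^+ 2)^-1 <= (x * (x + 1))^-1.
    by set u := _^-1; set v := _^-1; set w := _^-1; lra.
  by rewrite lef_pV2 ?posrE ?exprn_gt0 ?mulr_gt0 ?addr_gt0//; nra.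
apply: nondecreasing_is_cvgn.
  by apply/nondecreasing_seqP => k; rewrite /series/= big_nat_recr//= lerDl invr_ge0.
exists 2 => _ [n _ <-]; case: n => [|n]; first by rewrite /series/= big_geq.
by rewrite (le_trans (le2 n))// gerBl invr_ge0.
Qed.

Definition euler_seq z (n : nat) : C :=
  n`!%:R * cpow n%:R z / \prod_(k < n.+1) (z + k%:R).

Lemma addnat_neq0 z (k : nat) : 0 < Re z -> z + k%:R != 0.
Proof.
move=> z0; apply/eqP => /(congr1 Re); rewrite cReD Re_nat => h.
by have := ltr_wpDr (ler0n R k) z0; rewrite h ltxx.
Qed.

Lemma prod_addnat_neq0 z n : 0 < Re z -> \prod_(k < n) (z + k%:R) != 0.
Proof. by move=> z0; apply/prodf_neq0 => k _; exact: addnat_neq0. Qed.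

Lemma euler_seq_neq0 z n : 0 < Re z -> euler_seq z n != 0.
Proof.
move=> z0; rewrite /euler_seq !mulf_neq0 ?invr_eq0 ?prod_addnat_neq0 ?cpow_neq0//.
Qed.

Lemma euler_seqS z n : 0 < Re z -> euler_seq z n.+2 = euler_seq z n.+1 *
  (cpow (1 + n.+1%:R^-1) (z + 1) / (1 + (z + 1) * (n.+1%:R^-1)%:C)).
Proof.
move=> z0; rewrite /euler_seq big_ord_recr/= factS natrM.
set P := \prod_(k < n.+2) _.
have h0 : 0 < n.+1%:R :> R by [].
have -> : n.+2%:R = n.+1%:R * (1 + n.+1%:R^-1) :> R.
  by rewrite mulrDr mulr1 mulfV ?gt_eqF// natr1.
rewrite cpowMl ?addr_gt0 ?invr_gt0// cpowD (cpow1 (r := 1 + _)) ?addr_gt0 ?invr_gt0//.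
have P0 : P != 0 by exact: prod_addnat_neq0.
have N0 : n.+1%:R != 0 :> C by rewrite pnatr_eq0.
have zn : z + n.+2%:R != 0 by exact: addnat_neq0.
have -> : (n.+1%:R^-1 : R)%:C = n.+1%:R^-1 by rewrite fmorphV/= rmorph_nat.
rewrite !(rmorphD, fmorphV, rmorph_nat, rmorph1)/=.
have -> : n.+2%:R = n.+1%:R + 1 :> C by rewrite natr1.
field; rewrite P0 -natr1 addrC in N0 *; rewrite N0/= andbT.
by rewrite (_ : _ + _ = z + n.+2%:R)// -!natr1; ring.
Qed.

(** Numerator and denominator of the ratio in [euler_seqS] agree up to O(h^2):
    1 + (z + 1) h is the Taylor polynomial of (1 + h)^(z+1) at h = 0. *)
Lemma euler_ratio_bound z : 0 < Re z -> exists2 K, 0 <= K &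
  forall h : R, 0 <= h <= 1 ->
    normc (cpow (1 + h) (z + 1) - (1 + (z + 1) * h%:C)) <= K * h ^+ 2.
Proof.
move=> z0; set w := z + 1.
pose M := normc (w * z) * 2 `^ Re w.
exists (4 * M); first by rewrite !mulr_ge0 ?normc_ge0 ?powR_ge0.
move=> h /andP[h0 h1].
have Rew : Re w = Re z + 1 by rewrite cReD.
have := @cTaylor2_le _ (fun t => cpow t w) (fun t => w * cpow t (w - 1))
  (fun t => w * ((w - 1) * cpow t (w - 1 - 1))) 1 (1 + h) M.
rewrite !cpow1x mulr1 (_ : 1 + h - 1 = h); last by ring.
rewrite (_ : cpow (1 + h) w - 1 - w * h%:C = cpow (1 + h) w - (1 + w * h%:C));
  last by ring.
have t0 t : 1 <= t -> 0 < t by exact: lt_le_trans.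
have : 1 <= 1 + h by rewrite lerDl.
move=> h1' /(_ h1'); apply.
- by move=> t /andP[/t0 t1 _]; exact: cderiv_cpow.
- move=> t /andP[/t0 t1 _].
  have := cderivM (cderiv_cst t w) (cderiv_cpow (w - 1) t1).
  by rewrite mul0r add0r.
- move=> t /andP[t1 th]; rewrite /M mulrA Normc.normcM [w - 1]addrK.
  rewrite ler_wpM2l ?normc_ge0// normc_cpow ?t0//.
  apply: (@le_trans _ _ (t `^ Re w)).
    by rewrite ler_powR// cReB Rew/=; lra.
  by rewrite ge0_ler_powR ?nnegrE ?(ltW (t0 _ t1)) ?Rew ?addr_ge0 ?(ltW z0)//; lra.
Qed.

(** Numerator and denominator of the ratio both have modulus at least 1, so the
    relative steps of the sequence and of its inverse are O(1/n^2). *)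
Lemma euler_seq_steps z : 0 < Re z -> exists2 K, 0 <= K & forall n,
  normc (euler_seq z n.+2 - euler_seq z n.+1) <=
    normc (euler_seq z n.+1) * (K * (n.+1%:R ^+ 2)^-1) /\
  normc ((euler_seq z n.+2)^-1 - (euler_seq z n.+1)^-1) <=
    normc (euler_seq z n.+1)^-1 * (K * (n.+1%:R ^+ 2)^-1).
Proof.
move=> z0; have [K K0 hK] := euler_ratio_bound z0.
exists K => // n; set h : R := n.+1%:R^-1.
have h01 : 0 <= h <= 1 by rewrite invr_ge0 ler0n/= invf_le1// ler1n.
have {}hK := hK _ h01.
rewrite euler_seqS// -/h; set p := cpow _ _ in hK *; set q := 1 + (z + 1) * _ in hK *.
set e := euler_seq _ _.
have hE : (n.+1%:R ^+ 2)^-1 = h ^+ 2 by rewrite exprVn.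
rewrite hE.
have /andP[h0 h1] := h01.
have q1 : 1 <= normc q.
  apply: le_trans (Re_le_normc _); apply: le_trans (ler_norm _).
  by rewrite /q cReD cReM/= mulr0 subr0 lerDl mulr_ge0// cReD/= addr_ge0// ltW.
have p1 : 1 <= normc p.
  rewrite normc_cpow ?ltr_wpDr//.
  rewrite -[leLHS](powRr0 (1 + h)) ler_powR ?lerDl//.
  by rewrite cReD/= addr_ge0// ltW.
have q0 : q != 0 by rewrite -normc_gt0 (lt_le_trans _ q1).
have p0 : p != 0 by rewrite -normc_gt0 (lt_le_trans _ p1).
have e0 : e != 0 by exact: euler_seq_neq0.
split.
- have -> : e * (p / q) - e = e * ((p - q) / q) by field.
  rewrite (Normc.normcM e) ler_wpM2l ?normc_ge0// (Normc.normcM (p - q)) Normc.normcV.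
  rewrite (le_trans _ hK)// ler_piMr ?normc_ge0// invf_le1 ?(lt_le_trans _ q1)//.
- have -> : (e * (p / q))^-1 - e^-1 = e^-1 * ((p - q) * (- p^-1)).
    by field; rewrite p0 q0 e0.
  rewrite (Normc.normcM e^-1) ler_wpM2l ?normc_ge0// (Normc.normcM (p - q)) normcN Normc.normcV.
  rewrite (le_trans _ hK)// ler_piMr ?normc_ge0// invf_le1 ?(lt_le_trans _ p1)//.
Qed.

(** The sequence and its inverse both converge and the product of the limits is
    1; hence the limit is not 0. *)
Lemma cvg_Gamma_neq0 z : 0 < Re z ->
  ((fun n => euler_seq z n : C^o) @ \oo --> (Gamma z : C^o)) /\ Gamma z != 0.
Proof.
move=> z0; have [K K0 st] := euler_seq_steps z0.
have cK : cvgn (series (fun n => K * (n.+1%:R ^+ 2)^-1)).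
  exact: (is_cvg_seriesZ (k := K) is_cvg_series_invSsqr).
have K0' (n : nat) : 0 <= K * (n.+1%:R ^+ 2)^-1 by rewrite mulr_ge0.
have /cvg_ex[/= a ea] := cvg_small_steps K0' cK (fun n => (st n).1).
have /cvg_ex[/= b eb] := cvg_small_steps K0' cK (fun n => (st n).2).
have ea' : (fun n => euler_seq z n : C^o) @ \oo --> (a : C^o).
  by move: ea; rewrite (cvg_shiftS (fun n => euler_seq z n : C^o)).
have aG : Gamma z = a by exact: limC.
rewrite aG; split => //; apply/eqP => a00.
have ab : a * b = 1.
  apply: cvgC_unique (cvgC_M ea eb) _.
  under eq_fun do rewrite mulfV ?euler_seq_neq0//.
  exact: cvgC_cst.
by move/eqP : ab; rewrite a00 mul0r eq_sym oner_eq0.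
Qed.

Lemma normc_cpowE (r : R) z : normc (cpow r z) = expR (Re z * ln r).
Proof. by rewrite /cpow normc_cexp cReM/= mulr0 subr0. Qed.

Lemma normc_euler_seq z n : normc (euler_seq z n) =
  n`!%:R * expR (Re z * ln n%:R) / \prod_(k < n.+1) normc (z + k%:R).
Proof.
by rewrite /euler_seq 2!Normc.normcM Normc.normcV normc_prod normc_nat normc_cpowE.
Qed.

Lemma prod_normc_gt0 z n : 0 < Re z -> 0 < \prod_(k < n.+1) normc (z + k%:R).
Proof. by move=> z0; apply: prodr_gt0 => k _; rewrite normc_gt0 addnat_neq0. Qed.

(** In Euler's product the ratio |Gamma z| / Gamma (Re z) has the factors
    (Re z + k) / |z + k|, and none of them decreases when z moves to the right
    along a horizontal line. *)
Lemma normc_Gamma_shift z (l : R) : 0 < Re z -> 0 <= l ->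
  normc (Gamma z) * normc (Gamma (Re z + l)%:C) <=
  normc (Gamma (z + l%:C)) * normc (Gamma (Re z)%:C).
Proof.
move=> z0 l0.
have zl0 : 0 < Re z + l by exact: ltr_wpDr.
have zl0' : 0 < Re (z + l%:C) by rewrite cReD.
have c1 := cvgC_norm (cvg_Gamma_neq0 z0).1.
have c2 := cvgC_norm (cvg_Gamma_neq0 (z := (Re z + l)%:C) zl0).1.
have c3 := cvgC_norm (cvg_Gamma_neq0 zl0').1.
have c4 := cvgC_norm (cvg_Gamma_neq0 (z := (Re z)%:C) z0).1.
apply: (ler_cvg_to (cvgM c1 c2) (cvgM c3 c4)); near=> n.
rewrite /= !normc_euler_seq cReD/=.
set f : R := n`!%:R; set p := expR (Re z * _); set q := expR (_ * _).
set A := \prod_(k < _) _; set B := \prod_(k < _) _.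
set A' := \prod_(k < _) _; set B' := \prod_(k < _) _.
have A0 : 0 < A by exact: prod_normc_gt0.
have B0 : 0 < B by exact: prod_normc_gt0.
have A'0 : 0 < A' by exact: prod_normc_gt0.
have B'0 : 0 < B' by exact: prod_normc_gt0.
have -> : f * p / A * (f * q / B) = f ^+ 2 * p * q / (A * B).
  by field; rewrite !gt_eqF.
have -> : f * q / A' * (f * p / B') = f ^+ 2 * p * q / (A' * B').
  by field; rewrite !gt_eqF.
rewrite ler_wpM2l ?mulr_ge0 ?expR_ge0 ?exprn_ge0//.
rewrite lef_pV2 ?posrE ?mulr_gt0// -!big_split/=; apply: ler_prod => k _.
rewrite mulr_ge0 ?normc_ge0//= -(@ler_pXn2r _ 2) ?nnegrE ?mulr_ge0 ?normc_ge0//.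
rewrite !exprMn !normc_sqr !cReD !cImD/= !Re_nat !Im_nat !addr0 expr0n/= !addr0.
set s := Re z in z0 zl0 zl0' *; set t := Im z; set m : R := k%:R.
have m0 : 0 <= m by [].
rewrite !mulrDl lerD//.
  by rewrite mulrC.
rewrite ler_wpM2l ?sqr_ge0// ler_pXn2r ?nnegrE ?addr_ge0 ?(ltW z0)//.
by rewrite lerD2r lerDl.
Unshelve. all: by end_near. Qed.

Lemma normc_Gamma_le z : 0 < Re z -> normc (Gamma z) <= normc (Gamma (Re z)%:C).
Proof.
move=> z0.
have c1 := cvgC_norm (cvg_Gamma_neq0 z0).1.
have c2 := cvgC_norm (cvg_Gamma_neq0 (z := (Re z)%:C) z0).1.
apply: (ler_cvg_to c1 c2); near=> n; rewrite /= !normc_euler_seq/=.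
rewrite ler_wpM2l ?mulr_ge0 ?expR_ge0// lef_pV2 ?posrE.
- apply: ler_prod => k _; rewrite normc_ge0/=.
  rewrite -(@ler_pXn2r _ 2) ?nnegrE ?normc_ge0//.
  by rewrite !normc_sqr !cReD !cImD/= !Re_nat !Im_nat !addr0 expr0n/= addr0 lerDl sqr_ge0.
- exact: prod_normc_gt0.
- exact: (prod_normc_gt0 (z := (Re z)%:C)).
Unshelve. all: by end_near. Qed.

End EulerLimit.

(** * Integration of complex functions on the open unit interval *)

Section ImproperIntegral.
Context {R : realType}.
Local Notation C := R[i].
Local Notation Re := (@complex.Re R).
Local Notation Im := (@complex.Im R).
Local Notation normc := (@Normc.normc R).
Local Notation mu := (@lebesgue_measure R).
Local Notation I01 := (`]0%R, 1%R[%classic : set R).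

(** Compact subintervals of ]0, 1[, on which the fundamental theorem of calculus
    applies to integrands that blow up at 0 or 1. The offset 3 makes them
    nondegenerate from n = 0 on. *)
Definition exhaust (n : nat) : set R := `[n.+3%:R^-1, 1 - n.+3%:R^-1].

Lemma exhaust_bounds n : [/\ 0 < n.+3%:R^-1 :> R, n.+3%:R^-1 < 1 - n.+3%:R^-1 :> R &
  1 - n.+3%:R^-1 < 1 :> R].
Proof.
have h : (n.+3%:R^-1 : R) <= 3^-1 by rewrite lef_pV2 ?posrE// ler_nat.
have h0 : 0 < n.+3%:R^-1 :> R by [].
by move: (n.+3%:R^-1) h h0 => u h h0; split; lra.
Qed.

Lemma exhaust_sub n : exhaust n `<=` I01.
Proof.
have [h1 _ h2] := exhaust_bounds n.
move=> x; rewrite /exhaust/= !in_itv/= => /andP[xa xb].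
by rewrite (lt_le_trans h1)//= (le_lt_trans xb).
Qed.

Lemma cvg_invS3 : (fun n => n.+3%:R^-1 : R) @ \oo --> (0 : R).
Proof.
have := @cvg_harmonic R; rewrite -(cvg_shiftn 2).
by rewrite (_ : [sequence _]_n = (fun n => n.+3%:R^-1))//; apply/funext => n /=; rewrite addn2.
Qed.

Lemma exhaust_near x : I01 x -> \forall n \near \oo, exhaust n x.
Proof.
rewrite /= in_itv/= => /andP[x0 x1].
have d0 : 0 < Num.min x (1 - x) by rewrite lt_min x0 subr_gt0.
have /cvgr0Pnorm_le/(_ _ d0) := cvg_invS3.
apply: filterS => n; rewrite ger0_norm// le_min => /andP[h1 h2].
by rewrite /exhaust/= in_itv/= h1/= lerBrDr -lerBrDl.
Qed.

Lemma exhaust_bigcup : \bigcup_n exhaust n = I01.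
Proof.
apply/seteqP; split => [x [n _]|x /exhaust_near]; first exact: exhaust_sub.
by case=> N _ /(_ N (leqnn N)) ?; exists N.
Qed.

Lemma exhaust_nondecreasing : {homo exhaust : n m / (n <= m)%N >-> (n <= m)%O}.
Proof.
move=> n m nm; apply/subsetPset; apply: subset_itv => //; rewrite bnd_simp.
- by rewrite lef_pV2 ?posrE// ler_nat.
- by rewrite lerB// lef_pV2 ?posrE// ler_nat.
Qed.

Lemma measurable_exhaust n : measurable (exhaust n).
Proof. exact: measurable_itv. Qed.

Section FTC.
Variables (F f : R -> R).
Hypothesis Ff : forall t : R, 0 < t < 1 -> is_derive t 1 F (f t).
Hypothesis cf : forall t : R, 0 < t < 1 -> {for t, continuous f}.

Lemma measurable_fun_I01 : measurable_fun I01 f.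
Proof.
apply: open_continuous_measurable_fun; first exact: interval_open.
by move=> x; rewrite inE/= in_itv/= => x01; exact: cf.
Qed.

Lemma FTC_exhaust n : (\int[mu]_(x in exhaust n) (f x)%:E =
  (F (1 - n.+3%:R^-1) - F n.+3%:R^-1)%:E)%E.
Proof.
have [h0 h1 h2] := exhaust_bounds n.
have sub (t : R) : n.+3%:R^-1 <= t <= 1 - n.+3%:R^-1 -> 0 < t < 1.
  by move=> /andP[ta tb]; rewrite (lt_le_trans h0)//= (le_lt_trans tb).
have cF (t : R) : n.+3%:R^-1 <= t <= 1 - n.+3%:R^-1 -> {for t, continuous F}.
  move=> /sub t01; apply: differentiable_continuous; apply/derivable1_diffP.
  by have [] := Ff t01.
rewrite /exhaust (@continuous_FTC2 _ f F)//.
- apply: continuous_in_subspaceT => x; rewrite inE/= in_itv/= => xab.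
  by apply: cf; exact: sub.
- split.
  + move=> x; rewrite in_itv/= => /andP[xa xb].
    by have [] := @Ff x _; rewrite // sub// !ltW.
  + by apply: cvg_at_right_filter; apply: cF; rewrite lexx ltW.
  + by apply: cvg_at_left_filter; apply: cF; rewrite lexx ltW.
- move=> x; rewrite in_itv/= => /andP[xa xb]; rewrite derive1E.
  have x01 : 0 < x < 1 by rewrite sub// !ltW.
  by have [_] := Ff x01.
Qed.

(** The integrals over the exhausting intervals are increments of F, hence
    bounded by 2 M, and they increase to the integral of f. *)
Lemma ge0_integrable_FTC (M : R) : (forall t : R, 0 < t < 1 -> 0 <= f t) ->
  (forall t : R, 0 < t < 1 -> `|F t| <= M) -> mu.-integrable I01 (EFin \o f).
Proof.
move=> f0 FM; apply/integrableP; split.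
  by apply/measurable_EFinP; exact: measurable_fun_I01.
rewrite (_ : \int[mu]_(x in I01) _ = \int[mu]_(x in I01) (f x)%:E)%E; last first.
  apply: eq_integral => x; rewrite inE/= in_itv/= => x01.
  by rewrite ger0_norm// f0.
apply: (@le_lt_trans _ _ (M + M)%:E); last exact: ltry.
have cv : (\int[mu]_(x in exhaust n) (f x)%:E)%E @[n --> \oo] -->
    (\int[mu]_(x in I01) (f x)%:E)%E.
  rewrite -exhaust_bigcup; apply: ge0_nondecreasing_set_cvg_integral.
  - exact: exhaust_nondecreasing.
  - exact: measurable_exhaust.
  - move=> n; apply/measurable_EFinP.
    apply: measurable_funS measurable_fun_I01 => //; exact: exhaust_sub.
  - move=> n x /exhaust_sub; rewrite /= in_itv/= => x01.
    by rewrite lee_fin f0.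
apply: (cvge_le _ cv); near=> n; rewrite FTC_exhaust lee_fin.
have [h0 h1 h2] := exhaust_bounds n.
rewrite (le_trans (ler_norm _))// (le_trans (ler_normB _ _))//.
rewrite lerD//; apply: FM; rewrite ?h2 ?andbT ?h0/=.
- exact: lt_trans h1.
- exact: lt_trans h2.
Unshelve. all: by end_near. Qed.

(** The integrals over the exhausting intervals are increments of F, and they
    converge to the integral of f by domination by |f|. *)
Lemma integral_FTC (l0 l1 : R) : mu.-integrable I01 (EFin \o f) ->
  (fun n => F n.+3%:R^-1) @ \oo --> l0 ->
  (fun n => F (1 - n.+3%:R^-1)) @ \oo --> l1 ->
  \int[mu]_(x in I01) f x = l1 - l0.
Proof.
move=> intf F0 F1.
have mf := measurable_int _ intf.
have [] := @dominated_convergence _ _ _ mu I01 _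
  (fun n => (EFin \o f) \_ (exhaust n)) (EFin \o f) (fun x => `|f x|%:E).
- exact: measurable_itv.
- move=> n; apply/measurable_restrict => //; first exact: measurable_exhaust.
  by apply: measurable_funS mf => //; exact: measurable_itv.
- exact: mf.
- apply/aeW => x /exhaust_near xn; apply: cvg_near_cst.
  by apply: filterS xn => n xn; rewrite patchE mem_set.
- exact: integrable_abse intf.
- apply/aeW => x n _; rewrite patchE; case: ifP => _ //.
  by rewrite abse0 lee_fin.
move=> _ _ cv; rewrite /Rintegral.
suff -> : (\int[mu]_(x in I01) (f x)%:E = (l1 - l0)%:E)%E by [].
apply/esym; apply: cvg_unique cv => //=.
rewrite (_ : (fun n => _) = (fun n => (F (1 - n.+3%:R^-1) - F n.+3%:R^-1)%:E)).
  by apply: cvg_EFin; [near=> n|exact: cvgB].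
apply/funext => n; rewrite -FTC_exhaust -integral_mkcondr.
by rewrite setIidr//; exact: exhaust_sub.
Unshelve. all: by end_near. Qed.

End FTC.

Lemma eq_cintegral (f g : R -> C) : (forall t, 0 < t < 1 -> f t = g t) ->
  cintegral I01 f = cintegral I01 g.
Proof.
move=> fg; rewrite /cintegral; congr (_ +i* _); apply: eq_Rintegral => t;
  by rewrite inE/= in_itv/= => /fg ->.
Qed.

Lemma eq_cintegrable (f g : R -> C) : (forall t, 0 < t < 1 -> f t = g t) ->
  cintegrable I01 f -> cintegrable I01 g.
Proof.
move=> fg [fR fI]; split; [move: fR|move: fI]; apply: eq_integrable => // t;
  by rewrite inE/= in_itv/= => /fg ->.
Qed.

Lemma cintegrableZ c (f : R -> C) : cintegrable I01 f ->
  cintegrable I01 (fun t => c * f t).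
Proof.
move=> [fR fI]; split.
- rewrite (_ : EFin \o _ = (fun t => (Re c)%:E * (Re (f t))%:E) \-
    (fun t => (Im c)%:E * (Im (f t))%:E))%E.
    by apply: integrableB => //; exact: integrableZl.
  by apply/funext => t; rewrite /= cReM EFinB !EFinM.
- rewrite (_ : EFin \o _ = (fun t => (Re c)%:E * (Im (f t))%:E) \+
    (fun t => (Im c)%:E * (Re (f t))%:E))%E.
    by apply: integrableD => //; exact: integrableZl.
  by apply/funext => t; rewrite /= cImM EFinD !EFinM.
Qed.

Lemma cintegrableD (f g : R -> C) : cintegrable I01 f -> cintegrable I01 g ->
  cintegrable I01 (fun t => f t + g t).
Proof.
move=> [fR fI] [gR gI]; split.
- rewrite (_ : EFin \o _ = (fun t => (Re (f t))%:E) \+ (fun t => (Re (g t))%:E))%E.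
    exact: integrableD.
  by apply/funext => t; rewrite /= cReD EFinD.
- rewrite (_ : EFin \o _ = (fun t => (Im (f t))%:E) \+ (fun t => (Im (g t))%:E))%E.
    exact: integrableD.
  by apply/funext => t; rewrite /= cImD EFinD.
Qed.

Lemma cintegralD (f g : R -> C) : cintegrable I01 f -> cintegrable I01 g ->
  cintegral I01 (fun t => f t + g t) = cintegral I01 f + cintegral I01 g.
Proof.
move=> [fR fI] [gR gI]; apply: complex_ext; rewrite ?cReD ?cImD /=.
- by rewrite -RintegralD//; apply: eq_Rintegral => t _; rewrite cReD.
- by rewrite -RintegralD//; apply: eq_Rintegral => t _; rewrite cImD.
Qed.

Lemma integrable_mull (k : R) (f : R -> R) : mu.-integrable I01 (EFin \o f) ->
  mu.-integrable I01 (EFin \o (fun t => k * f t)).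
Proof.
move=> fi; rewrite (_ : EFin \o _ = (fun t => k%:E * (EFin \o f) t)%E).
  exact: integrableZl.
by apply/funext => t; rewrite /= EFinM.
Qed.

Lemma cintegralZ c (f : R -> C) : cintegrable I01 f ->
  cintegral I01 (fun t => c * f t) = c * cintegral I01 f.
Proof.
move=> [fR fI]; apply: complex_ext; rewrite ?cReM ?cImM /=.
- rewrite -!RintegralZl// -RintegralB//; try exact: integrable_mull.
  by apply: eq_Rintegral => t _; rewrite cReM.
- rewrite -!RintegralZl// -RintegralD//; try exact: integrable_mull.
  by apply: eq_Rintegral => t _; rewrite cImM.
Qed.

Lemma cintegralB (f g : R -> C) : cintegrable I01 f -> cintegrable I01 g ->
  cintegral I01 (fun t => f t - g t) = cintegral I01 f - cintegral I01 g.
Proof.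
move=> fi gi; rewrite -[- cintegral _ g]mulN1r -cintegralZ// -cintegralD//.
  by apply: eq_cintegral => t _; rewrite mulN1r.
exact: cintegrableZ.
Qed.

(** The factor 2 comes from estimating the real and imaginary parts
    separately. *)
Lemma normc_cintegral_le (f : R -> C) (g : R -> R) : cintegrable I01 f ->
  mu.-integrable I01 (EFin \o g) ->
  (forall t, 0 < t < 1 -> normc (f t) <= g t) ->
  normc (cintegral I01 f) <= 2 * \int[mu]_(t in I01) g t.
Proof.
move=> [fR fI] gi fg; rewrite mulr_natl mulr2n (le_trans (normc_le_ReIm _))//.
apply: lerD.
- apply: (le_trans (le_normr_Rintegral _ fR)) => //.
  apply: le_Rintegral => //; first exact: integrable_abse fR.
  by move=> t; rewrite /= in_itv/= => /fg; exact/le_trans/Re_le_normc.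
- apply: (le_trans (le_normr_Rintegral _ fI)) => //.
  apply: le_Rintegral => //; first exact: integrable_abse fI.
  by move=> t; rewrite /= in_itv/= => /fg; exact/le_trans/Im_le_normc.
Qed.

Definition ccontinuous (f : R -> C) (t : R) :=
  {for t, continuous (fun s => Re (f s))} /\ {for t, continuous (fun s => Im (f s))}.

Lemma ccontinuousD (f g : R -> C) t : ccontinuous f t -> ccontinuous g t ->
  ccontinuous (fun s => f s + g s) t.
Proof.
move=> [fR fI] [gR gI]; split.
- have -> : (fun s => Re (f s + g s)) = (fun s => Re (f s) + Re (g s)).
    by apply/funext => s; rewrite cReD.
  exact: cvgD fR gR.
- have -> : (fun s => Im (f s + g s)) = (fun s => Im (f s) + Im (g s)).
    by apply/funext => s; rewrite cImD.
  exact: cvgD fI gI.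
Qed.

Lemma ccontinuousZ (c : C) (f : R -> C) t : ccontinuous f t ->
  ccontinuous (fun s => c * f s) t.
Proof.
move=> [fR fI]; split.
- have -> : (fun s => Re (c * f s)) = (fun s => Re c * Re (f s) - Im c * Im (f s)).
    by apply/funext => s; rewrite cReM.
  exact: cvgB (cvgM (cvg_cst (Re c)) fR) (cvgM (cvg_cst (Im c)) fI).
- have -> : (fun s => Im (c * f s)) = (fun s => Re c * Im (f s) + Im c * Re (f s)).
    by apply/funext => s; rewrite cImM.
  exact: cvgD (cvgM (cvg_cst (Re c)) fI) (cvgM (cvg_cst (Im c)) fR).
Qed.

Lemma le_cintegrable (f : R -> C) (g : R -> R) :
  (forall t : R, 0 < t < 1 -> ccontinuous f t) ->
  mu.-integrable I01 (EFin \o g) ->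
  (forall t, 0 < t < 1 -> normc (f t) <= g t) -> cintegrable I01 f.
Proof.
move=> cf gi fg; split.
- apply: (le_integrable _ _ _ gi) => //.
    by apply/measurable_EFinP; apply: measurable_fun_I01 => t /cf[].
  move=> t; rewrite /= in_itv/= lee_fin => /fg h.
  by rewrite (le_trans (Re_le_normc _))// (le_trans h)// ler_norm.
- apply: (le_integrable _ _ _ gi) => //.
    by apply/measurable_EFinP; apply: measurable_fun_I01 => t /cf[].
  move=> t; rewrite /= in_itv/= lee_fin => /fg h.
  by rewrite (le_trans (Im_le_normc _))// (le_trans h)// ler_norm.
Qed.

Lemma cintegral_FTC (F f : R -> C) (l0 l1 : C) :
  (forall t : R, 0 < t < 1 -> cderiv t F (f t)) ->
  (forall t : R, 0 < t < 1 -> ccontinuous f t) ->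
  cintegrable I01 f ->
  (fun n => F n.+3%:R^-1 : C^o) @ \oo --> (l0 : C^o) ->
  (fun n => F (1 - n.+3%:R^-1) : C^o) @ \oo --> (l1 : C^o) ->
  cintegral I01 f = l1 - l0.
Proof.
move=> Ff cf [fR fI] F0 F1; apply: complex_ext; rewrite ?cReB ?cImB/=.
- apply: (@integral_FTC (fun t => Re (F t))) => //.
  + by move=> t /Ff[].
  + by move=> t /cf[].
  + exact: cvgC_Re F0.
  + exact: cvgC_Re F1.
- apply: (@integral_FTC (fun t => Im (F t))) => //.
  + by move=> t /Ff[].
  + by move=> t /cf[].
  + exact: cvgC_Im F0.
  + exact: cvgC_Im F1.
Qed.

End ImproperIntegral.

(** * The beta integral *)

Section BetaIntegral.
Context {R : realType}.
Local Notation C := R[i].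
Local Notation Re := (@complex.Re R).
Local Notation Im := (@complex.Im R).
Local Notation normc := (@Normc.normc R).
Local Notation mu := (@lebesgue_measure R).
Local Notation I01 := (`]0%R, 1%R[%classic : set R).
Implicit Types (a b : C).

Definition beta_integrand a b (t : R) : C := cpow t (a - 1) * cpow (1 - t) (b - 1).

Definition Beta a b : C := cintegral I01 (beta_integrand a b).

Lemma normc_beta_integrand a b (t : R) : 0 < t < 1 ->
  normc (beta_integrand a b t) = t `^ (Re a - 1) * (1 - t) `^ (Re b - 1).
Proof.
move=> /andP[t0 t1].
by rewrite Normc.normcM !normc_cpow ?subr_gt0// !cReB.
Qed.

Lemma cderiv_beta a b (t : R) : 0 < t < 1 ->
  cderiv t (fun s => cpow s a * cpow (1 - s) b)
    (a * beta_integrand a (b + 1) t - b * beta_integrand (a + 1) b t).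
Proof.
move=> /andP[t0 t1]; have t1' : 0 < 1 - t by rewrite subr_gt0.
have := cderivM (cderiv_cpow a t0) (cderiv_onem (cderiv_cpow b t1')).
by rewrite /beta_integrand !addrK; congr cderiv; ring.
Qed.

Lemma ccontinuous_beta a b (t : R) : 0 < t < 1 -> ccontinuous (beta_integrand a b) t.
Proof. by move=> t01; apply: cderiv_cts (cderiv_beta (a - 1) (b - 1) t01). Qed.

Lemma powR_le1 (r u : R) : 0 < r -> 0 < u < 1 -> u `^ r <= 1.
Proof.
move=> r0 /andP[u0 u1]; have -> : 1 = 1 `^ r :> R by rewrite powR1.
by rewrite ge0_ler_powR ?nnegrE ?(ltW r0) ?(ltW u0) ?(ltW u1).
Qed.

Lemma integrable_powR (s : R) : 0 < s ->
  mu.-integrable I01 (EFin \o (fun t => t `^ (s - 1))).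
Proof.
move=> s0.
have dpow (r t : R) : 0 < t < 1 -> is_derive t 1 (fun u => u `^ r) (r * t `^ (r - 1)).
  by move=> /andP[t0 _]; exact: is_derive1_powR.
apply: (@ge0_integrable_FTC _ (fun t => s^-1 * t `^ s) _ _ _ s^-1).
- move=> t t01; apply: (is_derive_eq (is_deriveZ s^-1 (dpow s t t01))).
  by rewrite /GRing.scale/= mulKf// gt_eqF.
- move=> t t01; apply: differentiable_continuous; apply/derivable1_diffP.
  by have [] := dpow (s - 1) t t01.
- by move=> t _; exact: powR_ge0.
- move=> t /andP[t0 t1]; rewrite ger0_norm ?mulr_ge0 ?invr_ge0 ?powR_ge0 ?(ltW s0)//.
  by rewrite ler_piMr ?invr_ge0 ?(ltW s0)// powR_le1// t0.
Qed.

Lemma integrable_onem_powR (s : R) : 0 < s ->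
  mu.-integrable I01 (EFin \o (fun t => (1 - t) `^ (s - 1))).
Proof.
move=> s0.
have dpow (r t : R) : 0 < t < 1 ->
    is_derive t 1 (fun u => (1 - u) `^ r) (- (r * (1 - t) `^ (r - 1))).
  move=> /andP[_ t1]; have t1' : 0 < 1 - t by rewrite subr_gt0.
  have onem : is_derive t 1 (fun s : R => 1 - s) (-1).
    rewrite (_ : (fun s => _) = cst 1 - id)//.
    by apply: is_derive_eq; rewrite sub0r.
  have := @is_derive1_comp _ _ (fun u : R => 1 - u) _ _ _ (is_derive1_powR r t1') onem.
  by rewrite mulrN1.
apply: (@ge0_integrable_FTC _ (fun t => - s^-1 * (1 - t) `^ s) (fun t => (1 - t) `^ (s - 1)) _ _ s^-1).
- move=> t t01; apply: (is_derive_eq (is_deriveZ (- s^-1) (dpow s t t01))).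
  by rewrite /GRing.scale/= mulrNN mulKf// gt_eqF.
- move=> t t01; apply: differentiable_continuous; apply/derivable1_diffP.
  by have [] := dpow (s - 1) t t01.
- by move=> t _; exact: powR_ge0.
- move=> t /andP[t0 t1].
  rewrite mulNr normrN ger0_norm ?mulr_ge0 ?invr_ge0 ?powR_ge0 ?(ltW s0)//.
  rewrite ler_piMr ?invr_ge0 ?(ltW s0)// powR_le1//.
  by rewrite subr_gt0 t1 gtrBl.
Qed.

Lemma powR_le_half (r u : R) : 2^-1 <= u <= 1 -> u `^ r <= 2 `^ `|r|.
Proof.
move=> /andP[u1 u2]; have u0 : 0 < u by rewrite (lt_le_trans _ u1).
rewrite /powR !gt_eqF// ler_expR.
have lnu : ln u <= 0 by rewrite -ln1 ler_ln ?posrE.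
have lnu2 : - ln u <= ln 2.
  by rewrite lerNl -lnV ?posrE// ler_ln ?posrE.
apply: (@le_trans _ _ (`|r| * - ln u)); last by rewrite ler_wpM2l.
by rewrite (le_trans (ler_norm _))// normrM (ler0_norm lnu).
Qed.

(** On each half of the interval one of the two factors is bounded, and the
    other one is integrable. *)
Lemma cintegrable_beta a b : 0 < Re a -> 0 < Re b ->
  cintegrable I01 (beta_integrand a b).
Proof.
move=> a0 b0; set r := Re a - 1; set s := Re b - 1.
pose K := 2 `^ `|r| + 2 `^ `|s|.
apply: (@le_cintegrable _ _ (fun t => K * (t `^ r + (1 - t) `^ s))).
- by move=> t; exact: ccontinuous_beta.
- apply: integrable_mull.
  rewrite (_ : EFin \o _ = (fun t => (t `^ r)%:E) \+ (fun t => ((1 - t) `^ s)%:E))%E//.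
  by apply: integrableD => //; [exact: integrable_powR|exact: integrable_onem_powR].
move=> t t01; rewrite normc_beta_integrand// -/r -/s.
have /andP[t0 t1] := t01.
have p0 (c u : R) : 0 <= c `^ u by exact: powR_ge0.
have [th|th] := leP t 2^-1.
- have : (1 - t) `^ s <= 2 `^ `|s| by apply: powR_le_half; lra.
  move: (p0 t r) (p0 (1 - t) s) (p0 2 `|r|) (p0 2 `|s|); rewrite /K.
  set A := t `^ r; set B := (1 - t) `^ s; set P := 2 `^ `|r|; set Q := 2 `^ `|s|.
  by move=> A0 B0 P0 Q0 BQ; have := mulr_ge0 A0 P0; have := mulr_ge0 B0 P0;
    have := mulr_ge0 B0 Q0; have := ler_wpM2l A0 BQ; lra.
- have : t `^ r <= 2 `^ `|r| by apply: powR_le_half; lra.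
  move: (p0 t r) (p0 (1 - t) s) (p0 2 `|r|) (p0 2 `|s|); rewrite /K.
  set A := t `^ r; set B := (1 - t) `^ s; set P := 2 `^ `|r|; set Q := 2 `^ `|s|.
  by move=> A0 B0 P0 Q0 BQ; have := mulr_ge0 A0 P0; have := mulr_ge0 A0 Q0;
    have := mulr_ge0 B0 Q0; have := ler_wpM2r B0 BQ; lra.
Qed.

Lemma Re_addr1_gt0 a : 0 < Re a -> 0 < Re (a + 1).
Proof. by move=> a0; rewrite cReD addr_gt0. Qed.

Lemma beta_integrandS1 a b (t : R) : 0 < t < 1 ->
  beta_integrand (a + 1) b t = t%:C * beta_integrand a b t.
Proof.
move=> /andP[t0 t1]; rewrite /beta_integrand (_ : a + 1 - 1 = a - 1 + 1); last by ring.
by rewrite [cpow t (_ + 1)]cpowD cpow1//; ring.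
Qed.

Lemma beta_integrandS2 a b (t : R) : 0 < t < 1 ->
  beta_integrand a (b + 1) t = (1 - t)%:C * beta_integrand a b t.
Proof.
move=> /andP[t0 t1]; rewrite /beta_integrand (_ : b + 1 - 1 = b - 1 + 1); last by ring.
by rewrite [cpow (1 - t) (_ + 1)]cpowD cpow1 ?subr_gt0//; ring.
Qed.

Lemma BetaD a b : 0 < Re a -> 0 < Re b -> Beta a b = Beta (a + 1) b + Beta a (b + 1).
Proof.
move=> a0 b0; rewrite /Beta -cintegralD; try by apply: cintegrable_beta => //; exact: Re_addr1_gt0.
apply: eq_cintegral => t t01.
by rewrite beta_integrandS1// beta_integrandS2// -mulrDl -rmorphD/= addrC subrK mul1r.
Qed.

Lemma cvg_powR_invS3 (s : R) : 0 < s -> (fun n => n.+3%:R^-1 `^ s : R) @ \oo --> (0 : R).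
Proof.
move=> s0; have /cvg_at_rightP := powR_cvg0 s0; apply.
by split; [move=> n; rewrite invr_gt0|exact: cvg_invS3].
Qed.

(** The two sides differ by the integral of the derivative of t^a (1 - t)^b,
    a function that tends to 0 at both ends. *)
Lemma Beta_parts a b : 0 < Re a -> 0 < Re b -> a * Beta a (b + 1) = b * Beta (a + 1) b.
Proof.
move=> a0 b0.
have i1 := cintegrableZ a (cintegrable_beta a0 (Re_addr1_gt0 b0)).
have i2 := cintegrableZ (- b) (cintegrable_beta (Re_addr1_gt0 a0) b0).
pose f t := a * beta_integrand a (b + 1) t + - b * beta_integrand (a + 1) b t.
have normF (t : R) : 0 < t < 1 -> normc (cpow t a * cpow (1 - t) b) =
    t `^ Re a * (1 - t) `^ Re b.
  by move=> /andP[t0 t1]; rewrite Normc.normcM !normc_cpow ?subr_gt0.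
have : cintegral I01 f = 0 - 0.
  apply: (@cintegral_FTC _ (fun t => cpow t a * cpow (1 - t) b)).
  - by move=> t t01; rewrite /f mulNr; exact: cderiv_beta.
  - move=> t t01; apply: ccontinuousD; apply: ccontinuousZ; exact: ccontinuous_beta.
  - exact: cintegrableD.
  - apply/cvgC_normc; apply: cvg_le0 (cvg_powR_invS3 a0) => n.
    have [h0 h1 h2] := exhaust_bounds (R := R) n.
    have h01 : 0 < (n.+3%:R^-1 : R) < 1 by rewrite h0 (lt_trans h1).
    rewrite subr0 normc_ge0 andTb normF// ler_piMr ?powR_ge0// powR_le1//.
    by rewrite h2 (lt_trans h0).
  - apply/cvgC_normc; apply: cvg_le0 (cvg_powR_invS3 b0) => n.
    have [h0 h1 h2] := exhaust_bounds (R := R) n.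
    rewrite subr0 normc_ge0 andTb normF; last by rewrite h2 (lt_trans h0).
    rewrite (_ : 1 - (1 - n.+3%:R^-1) = n.+3%:R^-1 :> R); last by ring.
    by rewrite ler_piMl ?powR_ge0// powR_le1// h2 (lt_trans h0).
rewrite cintegralD// !cintegralZ//; last 2 first.
- exact: cintegrable_beta (Re_addr1_gt0 a0) b0.
- exact: cintegrable_beta a0 (Re_addr1_gt0 b0).
by rewrite subr0 mulNr => /subr0_eq.
Qed.

Lemma BetaS a b : 0 < Re a -> 0 < Re b -> (a + b) * Beta a (b + 1) = b * Beta a b.
Proof.
move=> a0 b0; rewrite (BetaD a0 b0) mulrDr mulrDl Beta_parts//.
Qed.

Lemma Betan1 a : 0 < Re a -> Beta a 1 = a^-1.
Proof.
move=> a0; have an0 : a != 0.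
  by apply: contraTneq a0 => ->; rewrite ltxx.
have f1 (t : R) : 0 < t < 1 -> beta_integrand a 1 t = cpow t (a - 1).
  by move=> _; rewrite /beta_integrand subrr cpow0 mulr1.
have i1 : cintegrable I01 (beta_integrand a 1) by apply: cintegrable_beta.
have -> : Beta a 1 = cintegral I01 (fun t => cpow t (a - 1)) by exact: eq_cintegral.
apply: (mulfI an0); rewrite mulfV// -cintegralZ; last exact: eq_cintegrable i1.
rewrite (@cintegral_FTC _ (fun t => cpow t a) _ 0 1) ?subr0//.
- by move=> t /andP[t0 _]; exact: cderiv_cpow.
- move=> t /andP[t0 _]; have := cderiv_cts (cderivM (cderiv_cst t a) (cderiv_cpow (a - 1) t0)).
  by [].
- by apply: cintegrableZ; exact: eq_cintegrable i1.
- apply/cvgC_normc; apply: cvg_le0 (cvg_powR_invS3 a0) => n.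
  by rewrite subr0 normc_ge0 normc_cpow// lexx.
- rewrite -(cpow1x a); have [cR cI] := cderiv_cts (cderiv_cpow a (@ltr01 R)).
  have c1 : (fun n => 1 - n.+3%:R^-1 : R) @ \oo --> (1 : R).
    by rewrite -[X in _ --> X]subr0; apply: cvgB; [exact: cvg_cst|exact: cvg_invS3].
  by apply: cvgC_ReIm; [exact: (cvg_comp _ _ c1 cR)|exact: (cvg_comp _ _ c1 cI)].
Qed.

Lemma Betan a n : 0 < Re a -> Beta a n.+1%:R = n`!%:R / \prod_(k < n.+1) (a + k%:R).
Proof.
move=> a0; elim: n => [|n ih]; first by rewrite big_ord1 Betan1// addr0 mul1r.
have n0 : 0 < Re n.+1%:R by rewrite Re_nat.
have an0 : a + n.+1%:R != 0 by exact: addnat_neq0.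
apply: (mulfI an0); rewrite -[X in Beta _ X]natr1 BetaS// ih [in RHS]big_ord_recr/= factS natrM.
move: an0 (prod_addnat_neq0 n.+1 a0).
set X := a + n.+1%:R; set P := \prod_(_ < _) _ => X0 P0.
by field; rewrite X0 P0.
Qed.

Lemma euler_seq_Beta a n : 0 < Re a -> euler_seq a n = cpow n%:R a * Beta a n.+1%:R.
Proof. by move=> a0; rewrite Betan// /euler_seq; ring. Qed.

Lemma Beta_shift a b n : 0 < Re a -> 0 < Re b ->
  Beta a b * \prod_(k < n) (b + k%:R) = Beta a (b + n%:R) * \prod_(k < n) (a + b + k%:R).
Proof.
move=> a0 b0; elim: n => [|n ih]; first by rewrite !big_ord0 addr0.
have bn0 : 0 < Re (b + n%:R) by rewrite cReD Re_nat ltr_wpDr.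
rewrite !big_ord_recr/= mulrA ih -natr1 addrA.
have := BetaS a0 bn0; rewrite addrA mulrC => h.
set P := \prod_(k < n) _; rewrite [RHS]mulrCA [in RHS]mulrC.
by rewrite (mulrC (_ * P)) mulrA -h; ring.
Qed.

Lemma euler_seq_Beta_shift a b n : 0 < Re a -> 0 < Re b ->
  euler_seq b n * (cpow n%:R a * Beta a (b + n.+1%:R)) = euler_seq (a + b) n * Beta a b.
Proof.
move=> a0 b0; have ab0 : 0 < Re (a + b) by rewrite cReD addr_gt0.
have := Beta_shift n.+1 a0 b0; rewrite /euler_seq cpowD.
have := prod_addnat_neq0 n.+1 b0; have := prod_addnat_neq0 n.+1 ab0.
set P := \prod_(k < n.+1) (b + _); set Q := \prod_(k < n.+1) _ => Q0 P0 h.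
have -> : Beta a (b + n.+1%:R) = Beta a b * P / Q by rewrite h mulfK.
by field; rewrite P0 Q0.
Qed.

(** For t <= 1/2 this is the mean value inequality; for t > 1/2 the left-hand
    side is at most 2 < 4 t. *)
Lemma cpow_sub1_le b : 0 < Re b -> exists2 K, 0 <= K &
  forall t : R, 0 < t < 1 -> normc (cpow (1 - t) b - 1) <= K * t.
Proof.
move=> b0; pose M := normc b * 2 `^ `|Re b - 1|.
have M0 : 0 <= M by rewrite mulr_ge0 ?normc_ge0 ?powR_ge0.
exists (2 * M + 4); first by lra.
move=> t /andP[t0 t1]; have [th|th] := leP t 2^-1.
- rewrite -normcN opprB -[X in X - _](cpow1x b).
  apply: (@le_trans _ _ (2 * M * (1 - (1 - t)))).
    apply: (@cMVT_le _ (fun s => cpow s b) (fun s => b * cpow s (b - 1))); first by lra.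
    - by move=> s /andP[s1 s2]; apply: cderiv_cpow; lra.
    - move=> s /andP[s1 s2]; have s0 : 0 < s by lra.
      rewrite Normc.normcM normc_cpow// cReB ler_wpM2l ?normc_ge0//.
      by apply: powR_le_half; lra.
  by have := mulr_ge0 M0 (ltW t0); nra.
- apply: (@le_trans _ _ 2).
    rewrite (le_trans (le_normcD _ _))// normcN Normc.normc1.
    suff : normc (cpow (1 - t) b) <= 1 by lra.
    by rewrite normc_cpow ?subr_gt0// powR_le1// subr_gt0 t1 gtrBl.
  by have := mulr_ge0 M0 (ltW t0); nra.
Qed.

(** The difference is the integral of t^(a-1) (1 - t)^N ((1 - t)^b - 1), with
    N = n + 1. Since |(1 - t)^b - 1| <= K t, it is at most 2 K times
    B(Re a + 1, N + 1), and N^(Re a) B(Re a + 1, N + 1) is the N-th term of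
    Euler's convergent sequence for Re a + 1, divided by N. *)
Lemma Beta_asymptotic a b : 0 < Re a -> 0 < Re b ->
  (fun n => cpow n.+1%:R a * (Beta a (b + n.+2%:R) - Beta a n.+2%:R) : C^o) @ \oo -->
  (0 : C^o).
Proof.
move=> a0 b0; have [K K0 hK] := cpow_sub1_le b0.
have s0 : 0 < Re (Re a + 1)%:C by rewrite /= addr_gt0.
have cG := cvgC_norm (cvg_Gamma_neq0 s0).1.
set G := normc (Gamma _) in cG.
have bound n : normc (cpow n.+1%:R a * (Beta a (b + n.+2%:R) - Beta a n.+2%:R)) <=
    2 * K * (normc (euler_seq (Re a + 1)%:C n.+1) * n.+1%:R^-1).
  have n0 : 0 < Re n.+2%:R by rewrite Re_nat.
  have bn0 : 0 < Re (b + n.+2%:R) by rewrite cReD addr_gt0.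
  have i1 := cintegrable_beta a0 n0; have i2 := cintegrable_beta a0 bn0.
  have i3 := cintegrable_beta s0 n0.
  have hle : normc (Beta a (b + n.+2%:R) - Beta a n.+2%:R) <=
      2 * \int[mu]_(t in I01) (K * Re (beta_integrand (Re a + 1)%:C n.+2%:R t)).
    rewrite /Beta -cintegralB//; apply: normc_cintegral_le.
    - have := cintegrableD i2 (cintegrableZ (-1) i1).
      by apply: eq_cintegrable => t _; rewrite mulN1r.
    - by apply: integrable_mull; case: i3.
    - move=> t t01; have /andP[t0 t1] := t01.
      have t1' : 0 < 1 - t by rewrite subr_gt0.
      have -> : Re (beta_integrand (Re a + 1)%:C n.+2%:R t) =
          t `^ Re a * (1 - t) ^+ n.+1.
        rewrite /beta_integrand rmorphD addrK -[n.+2%:R]natr1 addrK.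
        by rewrite cpow_nat// cpow_real// -rmorphM.
      rewrite /beta_integrand.
      have -> : b + n.+2%:R - 1 = b + n.+1%:R by rewrite -[n.+2%:R]natr1; ring.
      have -> : n.+2%:R - 1 = n.+1%:R :> C by rewrite -[n.+2%:R]natr1 addrK.
      rewrite [cpow (1 - t) (b + _)]cpowD !(cpow_nat _ t1').
      set p := cpow t _; set q := cpow (1 - t) b; set r := (_ ^+ _)%:C.
      have -> : p * (q * r) - p * r = p * r * (q - 1) by ring.
      rewrite 2!Normc.normcM normc_cpow// cReB normc_real ger0_norm ?exprn_ge0 ?(ltW t1')//.
      have -> : t `^ Re a = t `^ (Re a - 1) * t.
        by rewrite -[X in _ * X](powRr1 (ltW t0)) -powRD ?subrK// (gt_eqF t0) implybT.
      have h := hK t t01; rewrite -/q in h.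
      have P0 : 0 <= t `^ (Re a - 1) * (1 - t) ^+ n.+1.
        by rewrite mulr_ge0 ?powR_ge0 ?exprn_ge0 ?(ltW t1').
      by rewrite (le_trans (ler_wpM2l P0 h))//; lra.
  have i3R : mu.-integrable I01
      (EFin \o (fun t => Re (beta_integrand (Re a + 1)%:C n.+2%:R t))) by case: i3.
  rewrite RintegralZl// in hle.
  rewrite Normc.normcM normc_cpow//.
  have N0 : 0 < n.+1%:R :> R by [].
  apply: (le_trans (ler_wpM2l (powR_ge0 _ _) hle)).
  rewrite euler_seq_Beta// Normc.normcM normc_cpow//=.
  have -> : n.+1%:R `^ (Re a + 1) = n.+1%:R `^ Re a * n.+1%:R :> R.
    by rewrite powRD ?powRr1// (gt_eqF N0) implybT.
  have hB : \int[mu]_(t in I01) Re (beta_integrand (Re a + 1)%:C n.+2%:R t) <=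
      normc (Beta (Re a + 1)%:C n.+2%:R).
    by rewrite (le_trans _ (Re_le_normc _))// ler_norm.
  move: hB; set J := \int[mu]_(t in _) _; set B := normc _; set P := _ `^ _ => JB.
  have -> : 2 * K * (P * n.+1%:R * B / n.+1%:R) = P * (2 * (K * B)).
    by field; rewrite gt_eqF.
  by rewrite ler_wpM2l ?powR_ge0// ler_wpM2l// ler_wpM2l.
apply/cvgC_normc.
under eq_fun do rewrite subr0.
apply: (@cvg_le0 _ _ (fun n => 2 * K *
    (normc (euler_seq (Re a + 1)%:C n.+1) * n.+1%:R^-1))).
  by move=> n; rewrite normc_ge0 andTb; exact: bound.
rewrite -[X in _ --> X](mulr0 (2 * K)); apply: cvgMr.
rewrite -[X in _ --> X](mulr0 G); apply: cvgM; last exact: cvg_harmonic.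
by move: cG; rewrite -(cvg_shiftS (fun n => normc (euler_seq _ n))).
Qed.

(** Euler's integral of the first kind: n^a B(a, b + n + 1) is on one hand
    asymptotic to n^a B(a, n + 1), the n-th term of Euler's sequence for
    Gamma a; on the other hand the recurrence in b expresses it by B(a, b) and
    the Euler sequences of Gamma b and Gamma (a + b). *)
Lemma Beta_Gamma a b : 0 < Re a -> 0 < Re b ->
  Beta a b * Gamma (a + b) = Gamma a * Gamma b.
Proof.
move=> a0 b0; have ab0 : 0 < Re (a + b) by rewrite cReD addr_gt0.
have shift z : 0 < Re z -> (fun n => euler_seq z n.+1 : C^o) @ \oo --> (Gamma z : C^o).
  by move=> /cvg_Gamma_neq0[+ _]; rewrite -(cvg_shiftS (fun n => euler_seq z n : C^o)).
have c1 := cvgC_M (@cvgC_cst _ (Beta a b)) (shift _ ab0).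
have c2 := cvgC_M (cvgC_D (shift _ a0) (Beta_asymptotic a0 b0)) (shift _ b0).
rewrite addr0 in c2.
move: c1; under eq_fun do rewrite mulrC -euler_seq_Beta_shift//.
move: c2; under eq_fun do rewrite (euler_seq_Beta _ a0) mulrBr addrC subrK mulrC.
by move=> c2 c1; exact: cvgC_unique c1 c2.
Qed.

End BetaIntegral.

(** * Termwise integration of double series *)

Section TermwiseIntegration.
Context {R : realType}.
Local Notation C := R[i].
Local Notation Re := (@complex.Re R).
Local Notation Im := (@complex.Im R).
Local Notation normc := (@Normc.normc R).
Local Notation mu := (@lebesgue_measure R).
Local Notation I01 := (`]0%R, 1%R[%classic : set R).

(** The sum of the g n dominates the partial sums, and it is integrable by the
    hypothesis on its integral. It may be infinite on a null set, which is why
    g takes extended real values. *)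
Lemma integral_series_dominated (f : nat -> R -> R) (g : nat -> R -> \bar R) (S : R -> R) :
  (forall n, mu.-integrable I01 (EFin \o f n)) ->
  (forall n, measurable_fun I01 (g n)) ->
  (forall n t, I01 t -> (`|f n t|%:E <= g n t)%E) ->
  (\sum_(n <oo) \int[mu]_(t in I01) g n t < +oo)%E ->
  (forall t, I01 t -> series (fun n => f n t) @ \oo --> S t) ->
  mu.-integrable I01 (EFin \o S) /\
  series (fun n => \int[mu]_(t in I01) f n t) @ \oo --> \int[mu]_(t in I01) S t.
Proof.
move=> fi mg fg gfin fS.
have g0 n t : I01 t -> (0 <= g n t)%E by move=> t01; exact: le_trans (fg n t t01).
pose G t := (\sum_(n <oo) g n t)%E.
have mG : measurable_fun I01 G.
  by apply: ge0_emeasurable_sum => // n t t01 _; exact: g0.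
have G0 t : I01 t -> (0 <= G t)%E.
  by move=> t01; apply: nneseries_ge0 => n _ _; exact: g0.
have iG : mu.-integrable I01 G.
  apply/integrableP; split => //.
  rewrite (_ : \int[mu]_(x in I01) `|G x| = \int[mu]_(x in I01) G x)%E; last first.
    by apply: eq_integral => x; rewrite inE => x01; rewrite gee0_abs// G0.
  by rewrite integral_nneseries.
pose P n t := series (fun k => f k t) n.
have PE n t : (P n t)%:E = (\sum_(0 <= k < n) (f k t)%:E)%E by rewrite /P /series/= sumEFin.
have iP n : mu.-integrable I01 (fun t => (P n t)%:E).
  rewrite (_ : (fun t => _) = (fun t => \sum_(0 <= k < n) (f k t)%:E)%E).
    by apply: integrable_sum => // k _; exact: fi.
  by apply/funext => t; exact: PE.
have PS t : I01 t -> (fun n => (P n t)%:E) @ \oo --> (S t)%:E.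
  by move=> t01; apply: cvg_EFin; [near=> n|exact: fS].
have [] := @dominated_convergence _ _ _ mu I01 _ (fun n t => (P n t)%:E) (EFin \o S) G.
- exact: measurable_itv.
- by move=> n; exact: measurable_int (iP n).
- apply: (@emeasurable_fun_cvg _ _ _ _ (fun n t => (P n t)%:E)) => //.
  by move=> n; exact: measurable_int (iP n).
- by apply/aeW => t; exact: PS.
- exact: iG.
- apply/aeW => t n t01; rewrite PE.
  apply: (@le_trans _ _ (\sum_(0 <= k < n) g k t)%E).
    apply: (le_trans (lee_abs_sum _ _ _)).
    by apply: lee_sum => k _; exact: fg.
  by apply: nneseries_lim_ge => k _ _; exact: g0.
move=> iS _ cv; split => //.
have fin : (\int[mu]_(t in I01) (S t)%:E)%E \is a fin_num.
  exact: integrable_fin_num iS.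
rewrite /Rintegral -(fineK fin) in cv *.
move: cv => /fine_cvg; rewrite fineK//.
suff -> : fine \o (fun n => \int[mu]_(x in I01) (P n x)%:E)%E =
    series (fun n => \int[mu]_(t in I01) f n t) by [].
apply/funext => n; rewrite /series/=.
under eq_integral do rewrite PE.
rewrite integral_sum// -sum_fine//.
by move=> k _; exact: integrable_fin_num (fi k).
Unshelve. all: by end_near. Qed.

Lemma cintegral_series_dominated (f : nat -> R -> C) (g : nat -> R -> \bar R) (S : R -> C) :
  (forall n, cintegrable I01 (f n)) ->
  (forall n, measurable_fun I01 (g n)) ->
  (forall n (t : R), 0 < t < 1 -> ((normc (f n t))%:E <= g n t)%E) ->
  (\sum_(n <oo) \int[mu]_(t in I01) g n t < +oo)%E ->
  (forall t : R, 0 < t < 1 -> series (fun n => f n t : C^o) @ \oo --> (S t : C^o)) ->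
  cintegrable I01 S /\
  series (fun n => cintegral I01 (f n) : C^o) @ \oo --> (cintegral I01 S : C^o).
Proof.
move=> fi mg fg gfin fS.
have ReS (u : nat -> C) : (fun n => Re (series (fun k => u k : C^o) n)) = series (fun k => Re (u k)).
  by apply/funext => n; rewrite /series/= Re_sum.
have ImS (u : nat -> C) : (fun n => Im (series (fun k => u k : C^o) n)) = series (fun k => Im (u k)).
  by apply/funext => n; rewrite /series/= Im_sum.
have [iR cR] : mu.-integrable I01 (EFin \o (fun t => Re (S t))) /\
    series (fun n => \int[mu]_(t in I01) Re (f n t)) @ \oo --> \int[mu]_(t in I01) Re (S t).
  apply: (integral_series_dominated (g := g)) => //.
  - by move=> n; case: (fi n).
  - move=> n t; rewrite /= in_itv/= => t01.
    by rewrite (le_trans _ (fg n t t01))// lee_fin Re_le_normc.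
  - by move=> t; rewrite /= in_itv/= => /fS /cvgC_Re; rewrite ReS.
have [iI cI] : mu.-integrable I01 (EFin \o (fun t => Im (S t))) /\
    series (fun n => \int[mu]_(t in I01) Im (f n t)) @ \oo --> \int[mu]_(t in I01) Im (S t).
  apply: (integral_series_dominated (g := g)) => //.
  - by move=> n; case: (fi n).
  - move=> n t; rewrite /= in_itv/= => t01.
    by rewrite (le_trans _ (fg n t t01))// lee_fin Im_le_normc.
  - by move=> t; rewrite /= in_itv/= => /fS /cvgC_Im; rewrite ImS.
by split => //; apply: cvgC_ReIm; rewrite ?ReS ?ImS.
Qed.

Lemma cvgn_series_summable (v : nat -> R) : (forall n, 0 <= v n) ->
  (\sum_(n <oo) (v n)%:E < +oo)%E -> cvgn (series v).
Proof.
move=> v0 vfin; apply: nondecreasing_is_cvgn.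
  by apply/nondecreasing_seqP => n; rewrite /series/= big_nat_recr//= lerDl.
have vf : (\sum_(n <oo) (v n)%:E)%E \is a fin_num.
  by rewrite ge0_fin_numE// nneseries_ge0// => n _ _; rewrite lee_fin.
exists (fine (\sum_(n <oo) (v n)%:E)%E) => _ [n _ <-].
rewrite -lee_fin fineK// /series/= -sumEFin.
by apply: nneseries_lim_ge => k _ _; rewrite lee_fin.
Qed.

Lemma normc_limn_series_le (u : nat -> C) :
  (\sum_(n <oo) (normc (u n))%:E < +oo)%E ->
  ((fun n => series (fun k => u k : C^o) n) @ \oo --> (limn (series (fun k => u k : C^o)) : C^o)) /\
  ((normc (limn (series (fun k => u k : C^o))))%:E <= \sum_(n <oo) (normc (u n))%:E)%E.
Proof.
move=> ufin.
have u0 n : (0 <= (normc (u n))%:E)%E by rewrite lee_fin normc_ge0.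
have cu : cvgn (series (fun k => u k : C^o)).
  apply: (@cvgC_series _ _ (fun n => normc (u n))) => //.
  by apply: cvgn_series_summable => // n; exact: normc_ge0.
have vf : (\sum_(n <oo) (normc (u n))%:E)%E \is a fin_num.
  by rewrite ge0_fin_numE// nneseries_ge0.
split; first exact: cu.
rewrite -[leRHS]fineK// lee_fin.
apply: (ler_cvg_to (cvgC_norm cu) (cvg_cst _)); near=> n.
rewrite -lee_fin fineK//; apply: (@le_trans _ _ (\sum_(0 <= k < n) (normc (u k))%:E)%E).
  by rewrite sumEFin lee_fin; exact: normc_sum_le.
exact: nneseries_lim_ge.
Unshelve. all: by end_near. Qed.

Lemma esum_pairs (v : nat -> nat -> \bar R) : (forall m n, 0 <= v m n)%E ->
  (\esum_(p in [set: nat * nat]) v p.1 p.2 = \sum_(m <oo) \sum_(n <oo) v m n)%E.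
Proof.
move=> v0; rewrite nneseries_esumT => [|m]; last exact: nneseries_ge0.
under [in RHS]eq_esum do rewrite nneseries_esumT//.
rewrite esum_esum//; congr esum.
by apply/seteqP; split => // -[m n].
Qed.

Definition dseries (u : nat -> nat -> C) : C :=
  limn (series (fun m => limn (series (u m : nat -> C^o)) : C^o)).

(** The inner sums are dominated by the sums of moduli, which are finite and
    summable. *)
Lemma cvg_dseries (u : nat -> nat -> C) :
  (\sum_(m <oo) \sum_(n <oo) (normc (u m n))%:E < +oo)%E ->
  (forall m, \sum_(n <oo) (normc (u m n))%:E < +oo)%E /\
  series (fun m => limn (series (u m : nat -> C^o)) : C^o) @ \oo --> (dseries u : C^o).
Proof.
move=> ufin.
have u0 m n : (0 <= (normc (u m n))%:E)%E by rewrite lee_fin normc_ge0.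
have U0 m : (0 <= \sum_(n <oo) (normc (u m n))%:E)%E by exact: nneseries_ge0.
have Ufin m : (\sum_(n <oo) (normc (u m n))%:E < +oo)%E.
  apply: le_lt_trans ufin.
  apply: le_trans (nneseries_lim_ge m.+1 (fun k _ _ => U0 k)).
  by rewrite big_nat_recr//= leeDr// sume_ge0.
split => //; apply: (@cvgC_series _ (fun m => limn (series (u m : nat -> C^o)))
  (fun m => fine (\sum_(n <oo) (normc (u m n))%:E)%E)).
  move=> m; rewrite -lee_fin fineK ?ge0_fin_numE//.
  exact: (normc_limn_series_le (Ufin m)).2.
apply: cvgn_series_summable => [m|]; first exact: fine_ge0.
by under eq_eseriesr do rewrite fineK ?ge0_fin_numE//.
Qed.

(** Dominated convergence is used for the inner sums with the moduli of the
    terms as bounds, then for the outer sum, where the inner sums of the moduli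
    are the bounds. *)
Lemma cintegral_dseries (f : nat -> nat -> R -> C) :
  (forall m n, cintegrable I01 (f m n)) ->
  (forall m n, measurable_fun I01 (fun t => normc (f m n t))) ->
  (\sum_(m <oo) \sum_(n <oo) \int[mu]_(t in I01) (normc (f m n t))%:E < +oo)%E ->
  (forall t : R, 0 < t < 1 ->
    (\sum_(m <oo) \sum_(n <oo) (normc (f m n t))%:E < +oo)%E) ->
  cintegrable I01 (fun t => dseries (fun m n => f m n t)) /\
  cintegral I01 (fun t => dseries (fun m n => f m n t)) =
    dseries (fun m n => cintegral I01 (f m n)).
Proof.
move=> fi mf Ifin pfin.
have I0 m n : (0 <= \int[mu]_(t in I01) (normc (f m n t))%:E)%E.
  by apply: integral_ge0 => t _; rewrite lee_fin normc_ge0.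
have II0 m : (0 <= \sum_(n <oo) \int[mu]_(t in I01) (normc (f m n t))%:E)%E.
  exact: nneseries_ge0.
have Imfin m : (\sum_(n <oo) \int[mu]_(t in I01) (normc (f m n t))%:E < +oo)%E.
  apply: le_lt_trans Ifin.
  apply: le_trans (nneseries_lim_ge m.+1 (fun k _ _ => II0 k)).
  by rewrite big_nat_recr//= leeDr// sume_ge0.
have mg m n : measurable_fun I01 (fun t => (normc (f m n t))%:E).
  by apply/measurable_EFinP; exact: mf.
pose S m t := limn (series (fun n => f m n t : C^o)).
have [Si Sk] : (forall m, cintegrable I01 (S m)) /\
    (forall m, cintegral I01 (S m) = limn (series (fun n => cintegral I01 (f m n) : C^o))).
  apply/all_and2 => m.
  have [iS cS] := cintegral_series_dominated (fi m) (mg m)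
    (fun n t _ => lexx _) (Imfin m)
    (fun t t01 => (normc_limn_series_le ((cvg_dseries (pfin t t01)).1 m)).1).
  by split => //; rewrite -(limC cS).
have gE m : (\int[mu]_(t in I01) (\sum_(n <oo) (normc (f m n t))%:E) =
    \sum_(n <oo) \int[mu]_(t in I01) (normc (f m n t))%:E)%E.
  have g0 n (t : R) : I01 t -> (0 <= (normc (f m n t))%:E)%E.
    by rewrite lee_fin normc_ge0.
  exact: (integral_nneseries mu (measurable_itv _) (mg m) g0).
have [] // := @cintegral_series_dominated S
  (fun m t => \sum_(n <oo) (normc (f m n t))%:E)%E
  (fun t => dseries (fun m n => f m n t)) Si.
- move=> m; apply: ge0_emeasurable_sum => // n t _ _.
  by rewrite lee_fin normc_ge0.
- move=> m t t01.
  exact: (normc_limn_series_le ((cvg_dseries (pfin t t01)).1 m)).2.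
- by under eq_eseriesr do rewrite gE.
- by move=> t t01; exact: (cvg_dseries (pfin t t01)).2.
move=> iS cS; split => //; apply/esym; apply: limC.
have E := funext Sk; move: cS; rewrite E; exact.
Qed.



Lemma dseriesZ (k : C) (u : nat -> nat -> C) :
  (\sum_(m <oo) \sum_(n <oo) (normc (u m n))%:E < +oo)%E ->
  dseries (fun m n => k * u m n) = k * dseries u.
Proof.
move=> /cvg_dseries[Ufin cu].
have inner m : limn (series (fun n => k * u m n : C^o)) = k * limn (series (u m : nat -> C^o)).
  apply: limC; have := cvgC_M (@cvgC_cst _ k) (normc_limn_series_le (Ufin m)).1.
  suff -> : (fun n => k * series (fun j => u m j : C^o) n) =
    series (fun n => k * u m n : C^o) by [].
  by apply/funext => n; rewrite /series/= big_distrr.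
rewrite /dseries; apply: limC; have := cvgC_M (@cvgC_cst _ k) cu.
suff -> : (fun n => k * series (fun m => limn (series (u m : nat -> C^o)) : C^o) n) =
  series (fun m => limn (series (fun n => k * u m n : C^o)) : C^o) by [].
apply/funext => n; rewrite /series/= big_distrr.
by apply: eq_bigr => m _; rewrite inner.
Qed.

End TermwiseIntegration.

(** * The Euler transform of a double series *)

Section EulerTransform.
Context {R : realType}.
Local Notation C := R[i].
Local Notation Re := (@complex.Re R).
Local Notation Im := (@complex.Im R).
Local Notation normc := (@Normc.normc R).
Local Notation mu := (@lebesgue_measure R).
Local Notation I01 := (`]0%R, 1%R[%classic : set R).

Lemma pochE (g : C) (l : R) : 0 < Re g -> poch g l = Gamma (g + l%:C) / Gamma g.
Proof.
move=> g0; rewrite /poch; case: asboolP => // -[k gk].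
by move: g0; rewrite gk cReN Re_nat oppr_gt0 ltNge ler0n.
Qed.

Variables (a c : C).
Hypotheses (a0 : 0 < Re a) (ac : Re a < Re c).

Let c0 : 0 < Re c. Proof. exact: lt_trans ac. Qed.
Let ca0 : 0 < Re (c - a). Proof. by rewrite cReB subr_gt0. Qed.

Lemma poch_Beta (l : R) : 0 <= l ->
  poch c l * Beta (a + l%:C) (c - a) = Gamma a * Gamma (c - a) / Gamma c * poch a l.
Proof.
move=> l0; have al0 : 0 < Re (a + l%:C) by rewrite cReD ltr_wpDr.
have := Beta_Gamma al0 ca0; rewrite (_ : a + l%:C + (c - a) = c + l%:C); last by ring.
move=> BG; rewrite !pochE//.
have Ga := (cvg_Gamma_neq0 a0).2; have Gc := (cvg_Gamma_neq0 c0).2.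
rewrite mulrAC (mulrC (Gamma (c + _))) BG.
by field; rewrite Ga Gc.
Qed.

Let s := Re a.
Let t := Re (c - a).

(** After [Beta_Gamma] the left-hand side is
    |Gamma (c + l)| / Gamma (Re c + l) times
    Gamma (Re a + l) Gamma (Re (c - a)) / |Gamma c|. The first factor is at most
    1, and Gamma (Re a + l) is at most |Gamma (a + l)| Gamma (Re a) / |Gamma a|. *)
Lemma normc_poch_Beta_le (l : R) : 0 <= l ->
  normc (poch c l) * normc (Beta (s + l)%:C t%:C) <=
  normc (Gamma s%:C) * normc (Gamma t%:C) / normc (Gamma c) * normc (poch a l).
Proof.
move=> l0; have sl0 : 0 < Re (s + l)%:C by rewrite /= ltr_wpDr.
have t0 : 0 < Re t%:C by [].
have cl0 : 0 < Re (c + l%:C) by rewrite cReD ltr_wpDr.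
have stE : (s + l)%:C + t%:C = (Re (c + l%:C))%:C.
  by rewrite -rmorphD; congr (_%:C); rewrite /s /t cReB cReD/=; ring.
have BG := congr1 normc (Beta_Gamma sl0 t0); move: BG.
rewrite stE !Normc.normcM.
have Gcl : 0 < normc (Gamma (Re (c + l%:C))%:C).
  by rewrite normc_gt0; exact: (cvg_Gamma_neq0 (z := (Re (c + l%:C))%:C) cl0).2.
have Ga : 0 < normc (Gamma a) by rewrite normc_gt0; exact: (cvg_Gamma_neq0 a0).2.
have Gc : 0 < normc (Gamma c) by rewrite normc_gt0; exact: (cvg_Gamma_neq0 c0).2.
have h1 := normc_Gamma_le cl0.
have h2 := normc_Gamma_shift a0 l0.
rewrite !pochE// !Normc.normcM !Normc.normcV -/s in h2 *.
have := normc_ge0 (Gamma t%:C).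
move: Gcl Ga Gc h1 h2.
set X := normc (Gamma (Re (c + _))%:C); set Y := normc (Gamma (c + _)).
set A := normc (Gamma a); set Cc := normc (Gamma c).
set B := normc (Beta _ _); set S := normc (Gamma s%:C).
set T := normc (Gamma t%:C); set SL := normc (Gamma (s + l)%:C).
set AL := normc (Gamma (a + l%:C)).
move=> X0 A0 C0 YX AS T0 BX.
have B0 : 0 <= B by exact: normc_ge0.
apply: (@le_trans _ _ (SL * T / Cc)).
  rewrite -BX mulrAC ler_pM2r ?invr_gt0// mulrC ler_wpM2l//.
have -> : S * T / Cc * (AL / A) = (AL * S) * (T / Cc / A).
  by field; rewrite !gt_eqF.
have -> : SL * T / Cc = (A * SL) * (T / Cc / A).
  by field; rewrite !gt_eqF.
by rewrite ler_wpM2r// !divr_ge0// ltW.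
Qed.

Variables (lam : nat -> nat -> R) (W : nat -> nat -> C).
Hypothesis lam0 : forall m n, 0 <= lam m n.
Hypothesis hl :
  (\sum_(m <oo) \sum_(n <oo) (normc (poch a (lam m n) * W m n))%:E < +oo)%E.
Hypothesis hr : forall xi : R, 0 < xi < 1 -> (\sum_(m <oo) \sum_(n <oo)
  (normc (poch c (lam m n) * W m n * (xi `^ lam m n)%:C))%:E < +oo)%E.

Let F (xi : R) : C := beta_integrand a (c - a) xi *
  dseries (fun m n => poch c (lam m n) * W m n * (xi `^ lam m n)%:C).

Let f m n (xi : R) : C := beta_integrand a (c - a) xi *
  (poch c (lam m n) * W m n * (xi `^ lam m n)%:C).

Let fE m n (xi : R) : 0 < xi < 1 ->
  f m n xi = poch c (lam m n) * W m n * beta_integrand (a + (lam m n)%:C) (c - a) xi.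
Proof.
move=> /andP[x0 x1]; rewrite /f /beta_integrand.
rewrite (_ : a + (lam m n)%:C - 1 = a - 1 + (lam m n)%:C); last by ring.
by rewrite [cpow xi (a - 1 + _)]cpowD cpow_real//; ring.
Qed.

Let al0 m n : 0 < Re (a + (lam m n)%:C).
Proof. by rewrite cReD ltr_wpDr//=. Qed.

Let fi m n : cintegrable I01 (f m n).
Proof.
have := cintegrableZ (poch c (lam m n) * W m n) (cintegrable_beta (al0 m n) ca0).
by apply: eq_cintegrable => xi xi01; rewrite fE.
Qed.

(** The modulus of a term is again a beta integrand, with real exponents. *)
Let rb m n (xi : R) : R := normc (poch c (lam m n) * W m n) *
  Re (beta_integrand (s + lam m n)%:C t%:C xi).

Let normf m n (xi : R) : 0 < xi < 1 -> normc (f m n xi) = rb m n xi.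
Proof.
move=> xi01; rewrite fE// Normc.normcM normc_beta_integrand// /rb.
have /andP[x0 x1] := xi01.
rewrite /beta_integrand -!(rmorphB _ _ 1) !cpow_real ?subr_gt0// -rmorphM.
by rewrite cReD.
Qed.

Let rbi m n : mu.-integrable I01 (EFin \o rb m n).
Proof.
apply: integrable_mull; have sl0 : 0 < Re (s + lam m n)%:C by rewrite /= ltr_wpDr.
have t0 : 0 < Re t%:C by [].
by case: (cintegrable_beta sl0 t0).
Qed.

Let mf m n : measurable_fun I01 (fun xi => normc (f m n xi)).
Proof.
apply: (@eq_measurable_fun _ _ _ _ _ (rb m n)).
  by move=> xi; rewrite inE/= in_itv/= => xi01; rewrite normf.
by apply/measurable_EFinP; exact: measurable_int (rbi m n).
Qed.

Let K : R := normc (Gamma s%:C) * normc (Gamma t%:C) / normc (Gamma c).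

Let intf_le m n : (\int[mu]_(xi in I01) (normc (f m n xi))%:E <=
  K%:E * (normc (poch a (lam m n) * W m n))%:E)%E.
Proof.
have -> : (\int[mu]_(xi in I01) (normc (f m n xi))%:E =
    \int[mu]_(xi in I01) (rb m n xi)%:E)%E.
  by apply: eq_integral; move=> xi; rewrite inE/= in_itv/= => xi01; rewrite normf.
have fin : (\int[mu]_(xi in I01) (rb m n xi)%:E)%E \is a fin_num.
  exact: integrable_fin_num (rbi m n).
rewrite -(fineK fin) -EFinM lee_fin.
have sl0 : 0 < Re (s + lam m n)%:C by rewrite /= ltr_wpDr.
have t0 : 0 < Re t%:C by [].
have [bR bI] := cintegrable_beta sl0 t0.
rewrite -/(Rintegral mu I01 (rb m n)) RintegralZl//.
apply: (@le_trans _ _ (normc (poch c (lam m n) * W m n) *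
    normc (Beta (s + lam m n)%:C t%:C))).
  rewrite ler_wpM2l ?normc_ge0// (le_trans _ (Re_le_normc _))//.
  exact: ler_norm.
rewrite !Normc.normcM mulrAC [leRHS]mulrA ler_wpM2r ?normc_ge0//.
exact: normc_poch_Beta_le.
Qed.

Let summ : (\sum_(m <oo) \sum_(n <oo)
  \int[mu]_(xi in I01) (normc (f m n xi))%:E < +oo)%E.
Proof.
have u0 m n : (0 <= (normc (poch a (lam m n) * W m n))%:E)%E.
  by rewrite lee_fin normc_ge0.
have U0 m : (0 <= \sum_(n <oo) (normc (poch a (lam m n) * W m n))%:E)%E.
  exact: nneseries_ge0.
have I0 m n : (0 <= \int[mu]_(xi in I01) (normc (f m n xi))%:E)%E.
  by apply: integral_ge0 => xi _; rewrite lee_fin normc_ge0.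
apply: (@le_lt_trans _ _ (K%:E *
    \sum_(m <oo) \sum_(n <oo) (normc (poch a (lam m n) * W m n))%:E)%E).
  rewrite -nneseriesZl//; apply: lee_nneseries => [m _ _|m _].
    exact: nneseries_ge0.
  rewrite -nneseriesZl//; apply: lee_nneseries => // n _; exact: intf_le.
apply: lte_mul_pinfty => //.
by rewrite lee_fin divr_ge0 ?mulr_ge0 ?normc_ge0.
Qed.

Let pfin (xi : R) : 0 < xi < 1 ->
  (\sum_(m <oo) \sum_(n <oo) (normc (f m n xi))%:E < +oo)%E.
Proof.
move=> xi01.
have u0 m n : (0 <= (normc (poch c (lam m n) * W m n * (xi `^ lam m n)%:C))%:E)%E.
  by rewrite lee_fin normc_ge0.
pose b := normc (beta_integrand a (c - a) xi).
rewrite (_ : (\sum_(m <oo) _)%E = (b%:E * \sum_(m <oo) \sum_(n <oo)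
    (normc (poch c (lam m n) * W m n * (xi `^ lam m n)%:C))%:E)%E).
  by apply: lte_mul_pinfty; [rewrite lee_fin normc_ge0| |exact: hr].
rewrite -nneseriesZl => [|m _]; last exact: nneseries_ge0.
apply: eq_eseriesr => m _; rewrite -nneseriesZl//; apply: eq_eseriesr => n _.
by rewrite /f Normc.normcM EFinM.
Qed.

(** Integrating term by term turns (c)_l into (a)_l, up to the constant k. *)
Lemma Euler_transform : cintegrable I01 F /\
  dseries (fun m n => poch a (lam m n) * W m n) =
  Gamma c / (Gamma a * Gamma (c - a)) * cintegral I01 F.
Proof.
have [iS cS] := cintegral_dseries fi mf summ pfin.
have FE (xi : R) : 0 < xi < 1 -> dseries (fun m n => f m n xi) = F xi.
  by move=> xi01; rewrite /f /F dseriesZ//; exact: hr.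
split; first exact: eq_cintegrable iS.
rewrite -(eq_cintegral FE) cS.
have Ga := (cvg_Gamma_neq0 a0).2; have Gc := (cvg_Gamma_neq0 c0).2.
have Gca := (cvg_Gamma_neq0 ca0).2.
set k := Gamma a * Gamma (c - a) / Gamma c.
have -> : (fun m n => cintegral I01 (f m n)) =
    (fun m n => k * (poch a (lam m n) * W m n)).
  apply/funext => m; apply/funext => n.
  rewrite (eq_cintegral (fE m n)) cintegralZ; last exact: (cintegrable_beta (al0 m n) ca0).
  rewrite -/(Beta _ _) mulrAC poch_Beta//; rewrite /k; ring.
rewrite dseriesZ// /k; field.
by rewrite Ga Gc Gca.
Qed.

End EulerTransform.

Section D1terms.
Context {R : realType}.
Local Notation C := R[i].
Local Notation Re := (@complex.Re R).
Local Notation Im := (@complex.Im R).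
Local Notation normc := (@Normc.normc R).
Variables (a1 b1 : R) (g2 : C) (a2 : R) (g3 : C) (b2 : R).
Variables (d1 : C) (a3 b3 : R) (d2 : C) (a4 : R) (d3 : C) (b4 : R).

(** The factors of a term of D1 other than the Pochhammer symbol of the first
    parameter. *)
Definition D1_weight (x y : C) (m n : nat) : C :=
  poch g2 (a2 * m%:R) * poch g3 (b2 * n%:R)
    / Gamma (d1 + (a3 * m%:R + b3 * n%:R)%:C)
  * (x ^+ m / Gamma (d2 + (a4 * m%:R)%:C))
  * (y ^+ n / Gamma (d3 + (b4 * n%:R)%:C)).

Lemma D1_termE g x y : D1_term g a1 b1 g2 a2 g3 b2 d1 a3 b3 d2 a4 d3 b4 x y =
  (fun m n => poch g (a1 * m%:R + b1 * n%:R) * D1_weight x y m n).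
Proof.
by apply/funext => m; apply/funext => n; rewrite /D1_term /D1_weight !mulrA.
Qed.

Lemma D1_weight_scale x y (xi : R) m n : 0 < xi ->
  D1_weight (x * (xi `^ a1)%:C) (y * (xi `^ b1)%:C) m n =
  D1_weight x y m n * (xi `^ (a1 * m%:R + b1 * n%:R))%:C.
Proof.
move=> xi0; rewrite powRD ?(gt_eqF xi0) ?implybT// !powRrM !powR_mulrn ?powR_ge0//.
by rewrite /D1_weight !exprMn -!rmorphXn rmorphM/=; ring.
Qed.

Lemma D1_abs_cvgE g x y :
  D1_abs_cvg g a1 b1 g2 a2 g3 b2 d1 a3 b3 d2 a4 d3 b4 x y <->
  (\sum_(m <oo) \sum_(n <oo)
    (normc (poch g (a1 * m%:R + b1 * n%:R) * D1_weight x y m n))%:E < +oo)%E.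
Proof.
rewrite -esum_pairs => [|m n]; last by rewrite lee_fin normc_ge0.
by rewrite /D1_abs_cvg D1_termE.
Qed.

Lemma D1E g x y : D1 g a1 b1 g2 a2 g3 b2 d1 a3 b3 d2 a4 d3 b4 x y =
  dseries (fun m n => poch g (a1 * m%:R + b1 * n%:R) * D1_weight x y m n).
Proof. by rewrite /D1 D1_termE. Qed.

End D1terms.

Theorem mainTheorem6 (R : realType)
  (g1 g2 g3 d1 d2 d3 x y : R[i])
  (a1 a2 a3 a4 b1 b2 b3 b4 : R) (mu : R[i])
  (a1_gt0 : 0 < a1) (a2_gt0 : 0 < a2) (a3_gt0 : 0 < a3) (a4_gt0 : 0 < a4)
  (b1_gt0 : 0 < b1) (b2_gt0 : 0 < b2) (b3_gt0 : 0 < b3) (b4_gt0 : 0 < b4)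
  (g1_gt0 : 0 < complex.Re g1) (mu_gt : complex.Re g1 < complex.Re mu)
  (cvg_l : D1_abs_cvg g1 a1 b1 g2 a2 g3 b2 d1 a3 b3 d2 a4 d3 b4 x y)
  (cvg_r : forall xi : R, 0 < xi < 1 ->
     D1_abs_cvg mu a1 b1 g2 a2 g3 b2 d1 a3 b3 d2 a4 d3 b4
       (x * (xi `^ a1)%:C) (y * (xi `^ b1)%:C)) :
  let integrand (xi : R) : R[i] :=
    cpow xi (g1 - 1) * cpow (1 - xi) (mu - g1 - 1) *
    D1 mu a1 b1 g2 a2 g3 b2 d1 a3 b3 d2 a4 d3 b4
      (x * (xi `^ a1)%:C) (y * (xi `^ b1)%:C) in
  cintegrable `]0, 1[ integrand /\
  D1 g1 a1 b1 g2 a2 g3 b2 d1 a3 b3 d2 a4 d3 b4 x y =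
    Gamma mu / (Gamma g1 * Gamma (mu - g1)) * cintegral `]0, 1[ integrand.
Proof.
move=> integrand.
pose lam (m n : nat) : R := a1 * m%:R + b1 * n%:R.
pose W := D1_weight g2 a2 g3 b2 d1 a3 b3 d2 a4 d3 b4 x y.
have lam0 m n : 0 <= lam m n by rewrite addr_ge0// mulr_ge0// ltW.
have scale (xi : R) : 0 < xi < 1 ->
    (fun m n => poch mu (lam m n) * D1_weight g2 a2 g3 b2 d1 a3 b3 d2 a4 d3 b4
      (x * (xi `^ a1)%:C) (y * (xi `^ b1)%:C) m n) =
    (fun m n => poch mu (lam m n) * W m n * (xi `^ lam m n)%:C).
  move=> /andP[xi0 _]; apply/funext => m; apply/funext => n.
  by rewrite D1_weight_scale// mulrA.
have hr (xi : R) : 0 < xi < 1 -> (\sum_(m <oo) \sum_(n <oo)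
    (Normc.normc (poch mu (lam m n) * W m n * (xi `^ lam m n)%:C))%:E < +oo)%E.
  move=> xi01; have /D1_abs_cvgE := cvg_r xi xi01.
  have E := scale xi xi01.
  under eq_eseriesr do under eq_eseriesr do
    rewrite -/(lam _ _) (congr1 (fun u => u _ _) E).
  by [].
have hl := (D1_abs_cvgE a1 b1 g2 a2 g3 b2 d1 a3 b3 d2 a4 d3 b4 g1 x y).1 cvg_l.
have [iF dF] := Euler_transform g1_gt0 mu_gt lam0 hl hr.
have FE (xi : R) : 0 < xi < 1 -> beta_integrand g1 (mu - g1) xi *
    dseries (fun m n => poch mu (lam m n) * W m n * (xi `^ lam m n)%:C) = integrand xi.
  by move=> xi01; rewrite /integrand D1E -(scale xi xi01).
split; first exact: eq_cintegrable FE iF.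
by rewrite D1E -(eq_cintegral FE).
Qed.
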